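(* Let $\mathbb F=\mathbb Q(q,t)$ and let $f(1_n)$ be the partition function of lattice paths on the $n\times n$ grid with identity connectivity, $$f(1_n)=\alpha_n\sum_{P:\ \mathrm{conn}(P)=\mathrm{id}}\mathrm{wt}(P).$$ Then $f(1_n)\in\mathbb F[x_1^\pm,\dots,x_n^\pm]_0^{\mathcal S_n}$, and the sequence $(f(1_n))_{n\ge0}$ is determined by $f(1_0)=1$ and the recurrence relation, for $n\ge1$, $$(x_1+\dots+x_n)\,f(1_n)=\sum_{i=1}^nx_i\,f(1_{n-1})[\hat x_i]\prod_{1\le j\le n,\ j\ne i}\frac{(1-q^{-1}x_j/x_i)(1-qt^{-1}x_j/x_i)(1-t\,x_j/x_i)}{-x_j/x_i\,(1-x_j/x_i)},$$ where $f(1_{n-1})[\hat x_i]$ denotes $f(1_{n-1})$ evaluated at the $n-1$ variables $x_1,\dots,x_{i-1},x_{i+1},\dots,x_n$.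
   Context: $\mathbb F[x_1^\pm,\dots,x_n^\pm]_0$ is the $\mathbb F$-span of the monomials $x_1^{i_1}\cdots x_n^{i_n}$, $i_j\in\mathbb Z$, with $|\sum_{j=1}^ri_j|\le r(n-r)$ for $0\le r\le n$; the superscript $\mathcal S_n$ denotes symmetric Laurent polynomials. **Lattice paths.** On an $n\times n$ square grid (rows $1,\dots,n$ from top to bottom, columns $1,\dots,n$ from left to right) consider $n$ paths made of right and up steps, one entering at each left external edge and one exiting at each top external edge, no path using the right or bottom external edges, and each edge being used by at most one path. Paths are labelled $1,\dots,n$ by their entry row from top to bottom. $\mathrm{conn}(P)=w\in\mathcal S_n$ if path $i$ exits at the $w^{-1}(i)$-th top edge from the left, for all $i$; thus $\mathrm{conn}(P)=\mathrm{id}$ means path $i$ exits at the $i$-th top edge. Give an edge the label of the path on it, or $\infty$ if empty. The weight $\mathrm{wt}(P)$ is the product over vertices (row $i$, column $j$) of the following factor: if the left and top edges have label $a$ and the bottom and right edges have label $b$: $1-t$ if $a<b$, and $q^{-1}x_ix_j^{-1}(1-t)$ if $a>b$; if the left and right edges have label $a$ and the bottom and top edges have label $b$: $t(1-q^{-1}x_ix_j^{-1})$ if $a<b$, and $1-q^{-1}x_ix_j^{-1}$ if $a>b$; if all four edges are empty: $1-tq^{-1}x_ix_j^{-1}$. Finally $\alpha_n=(q/t)^{n(n-1)/2}(1-t)^{-n}$. *)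

(* Defs.v *)
From HB Require Import structures.
From mathcomp Require Import all_boot all_order all_fingroup all_algebra.
From mathcomp Require Import mpoly.
Set Implicit Arguments.
Unset Strict Implicit.
Unset Printing Implicit Defensive.
Import Order.TTheory GRing.Theory Num.Theory.
Local Open Scope ring_scope.


Definition ratfun (K : fieldType) (n : nat) : fieldType :=
  {fraction {mpoly K[n]}}.

Definition ratC (K : fieldType) (n : nat) (c : K) : ratfun K n :=
  tofrac (c%:MP_[n]).

Definition ratX (K : fieldType) (n : nat) (i : 'I_n) : ratfun K n :=
  tofrac ('X_i : {mpoly K[n]}).

(* The value of [f] at the point [v], whose coordinates are rational functions
   in [m] variables.  It does not depend on the chosen fraction as long as the
   denominators do not vanish at [v]; this holds whenever the coordinates are
   algebraically independent, in particular pairwise distinct variables. *)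
Definition ratEval (K : fieldType) (n m : nat) (f : ratfun K n)
    (v : 'I_n -> ratfun K m) : ratfun K m :=
  let r : {ratio {mpoly K[n]}} := generic_quotient.repr (f : {fraction {mpoly K[n]}}) in
  mmap (@ratC K m) v \n_r / mmap (@ratC K m) v \d_r.

Definition symmetric_ratfun (K : fieldType) (n : nat) (f : ratfun K n) : Prop :=
  forall s : 'S_n, ratEval f (fun i => ratX K (s i)) = f.

Definition laurent_monomial (K : fieldType) (n : nat) (e : {ffun 'I_n -> int}) :
    ratfun K n :=
  \prod_(j < n) ratX K j ^ e j.

Definition admissible_exponent (n : nat) (e : {ffun 'I_n -> int}) : Prop :=
  forall r : nat, (r <= n)%N ->
    `| \sum_(j < n | (j < r)%N) e j | <= (r * (n - r))%:Z.

Definition laurent0 (K : fieldType) (n : nat) (f : ratfun K n) : Prop :=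
  exists (s : seq {ffun 'I_n -> int}) (c : {ffun 'I_n -> int} -> K),
    (forall e, e \in s -> admissible_exponent e) /\
    f = \sum_(e <- s) ratC n (c e) * laurent_monomial K e.


(* [inl (i, k)] is the k-th edge from the left in row [i], and [inr (k, j)] the
   k-th edge from the top in column [j]; all indices start from 0. *)
Definition edge (n : nat) : finType :=
  (('I_n * 'I_n.+1) + ('I_n.+1 * 'I_n))%type.

Definition edge_left (n : nat) (i j : 'I_n) : edge n :=
  inl (i, widen_ord (leqnSn n) j).
Definition edge_right (n : nat) (i j : 'I_n) : edge n :=
  inl (i, lift ord0 j).
Definition edge_top (n : nat) (i j : 'I_n) : edge n :=
  inr (widen_ord (leqnSn n) i, j).
Definition edge_bottom (n : nat) (i j : 'I_n) : edge n :=
  inr (lift ord0 i, j).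

Definition ext_left (n : nat) (i : 'I_n) : edge n := inl (i, ord0).
Definition ext_right (n : nat) (i : 'I_n) : edge n := inl (i, ord_max).
Definition ext_top (n : nat) (j : 'I_n) : edge n := inr (ord0, j).
Definition ext_bottom (n : nat) (j : 'I_n) : edge n := inr (ord_max, j).

(* A path enters a vertex from the left or from below, and leaves it to the
   right or upwards. *)
Definition path_step (n : nat) : rel (edge n) := fun e e' =>
  [exists i : 'I_n, exists j : 'I_n,
    (e \in [:: edge_left i j; edge_bottom i j]) &&
    (e' \in [:: edge_right i j; edge_top i j])].

(* The i-th path of a family, as the sequence of its edges.  A path from a left
   external edge to a top external edge has at most 2n edges, so the length
   bound excludes nothing; it makes the type of families finite. *)
Definition path_family (n : nat) : finType :=
  {ffun 'I_n -> {bseq n.*2 of edge n}}.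

Definition path_exits_at (n : nat) (p : seq (edge n)) (j : 'I_n) : bool :=
  ohead (rev p) == Some (ext_top j).

Definition lattice_paths (n : nat) (P : path_family n) : bool :=
  [&& [forall i, (ohead (P i) == Some (ext_left i))
        && sorted (@path_step n) (P i)],
      [forall j, exists i, path_exits_at (P i) j],
      [forall i, forall j, (ext_right j \notin (P i : seq (edge n)))
        && (ext_bottom j \notin (P i : seq (edge n)))]
    & [forall i, forall k, (i != k) ==>
        ~~ has (mem (P i : seq (edge n))) (P k)]].

Definition conn (n : nat) (P : path_family n) (w : 'S_n) : bool :=
  [forall i, path_exits_at (P i) ((w^-1)%g i)].

(* The path labels are 0, ..., n-1, and the value [n] stands for the label
   infinity of an empty edge. *)
Definition label (n : nat) (P : path_family n) (e : edge n) : nat :=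
  if [pick a | e \in (P a : seq (edge n))] is Some a then val a else n.

(* For a family satisfying [lattice_paths], the last branch is reached exactly
   when the four edges around the vertex are empty. *)
Definition vertex_weight (n : nat) (R : fieldType) (q t : R) (x : 'I_n -> R)
    (P : path_family n) (i j : 'I_n) : R :=
  let l := label P (edge_left i j) in
  let u := label P (edge_top i j) in
  let r := label P (edge_right i j) in
  let d := label P (edge_bottom i j) in
  let y := q^-1 * x i * (x j)^-1 in
  if [&& l == u, d == r & (l < d)%N] then 1 - t
  else if [&& l == u, d == r & (d < l)%N] then y * (1 - t)
  else if [&& l == r, d == u & (l < d)%N] then t * (1 - y)
  else if [&& l == r, d == u & (d < l)%N] then 1 - y
  else 1 - t * y.

Definition wt (n : nat) (R : fieldType) (q t : R) (x : 'I_n -> R)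
    (P : path_family n) : R :=
  \prod_(i < n) \prod_(j < n) vertex_weight q t x P i j.

Definition alpha (n : nat) (R : fieldType) (q t : R) : R :=
  (q / t) ^+ (n * n.-1)./2 * (1 - t) ^- n.

Definition partition_function (n : nat) (R : fieldType) (q t : R)
    (x : 'I_n -> R) (w : 'S_n) : R :=
  alpha n q t * \sum_(P : path_family n | lattice_paths P && conn P w)
                  wt q t x P.


Definition Fqt : fieldType := ratfun rat 2.
Definition q_ : Fqt := ratX rat (ord0 : 'I_2).
Definition t_ : Fqt := ratX rat (ord_max : 'I_2).

Definition qn (n : nat) : ratfun Fqt n := ratC n q_.
Definition tn (n : nat) : ratfun Fqt n := ratC n t_.

Definition f1 (n : nat) : ratfun Fqt n :=
  partition_function (qn n) (tn n) (@ratX Fqt n) 1%g.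

(* The recurrence relating the terms of index [n] and [n.+1] of the sequence
   [g]; [lift i] enumerates increasingly the indices different from [i]. *)
Definition recurrence (g : forall n : nat, ratfun Fqt n) (n : nat) : Prop :=
  let x := @ratX Fqt n.+1 in
  let q := qn n.+1 in
  let t := tn n.+1 in
  (\sum_(i < n.+1) x i) * g n.+1 =
  \sum_(i < n.+1) x i * ratEval (g n) (fun j : 'I_n => x (lift i j)) *
    \prod_(j < n.+1 | j != i)
      ((1 - q^-1 * (x j / x i)) * (1 - q * t^-1 * (x j / x i))
         * (1 - t * (x j / x i))
       / (- (x j / x i) * (1 - x j / x i))).

(* Main.v *)
(* The labels met along a lattice path from the top left to the bottom right
   corner of the grid form a word, on which the vertex (i, j) acts by
   R_k(u) = (1 - u) T_k + (1 - t) u, where k = i + j, u = q^-1 x_i / x_j and the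
   T_k generate a Hecke algebra.  Thus f(1_n) is, up to alpha_n, the diagonal
   matrix element Theta(Z), at the word 1 ... n followed by n empty edges, of
   the product Z of these n^2 operators.

   A partial fraction expansion gives, in the Hecke algebra on n strands,
     sum_i x_i A_i G B_i / prod_(j != i) (1 - x_j / x_i) = t^(n-1) sum_i x_i,
   where A_i and B_i are the products of the R_k(x_j / x_i) over j < i and over
   j > i and G is a product of inverse generators.  Multiply by Z and apply
   Theta.  Since Theta(X Z) = Theta(Z X) for X acting on the first n strands,
   the i-th term becomes Theta(B_i Z A_i G), where the Yang-Baxter equation
   makes B_i and A_i move the i-th row to the bottom and the i-th column to the
   left.  There the path with the largest label is frozen along the first
   column, which leaves the lattice of size n - 1 in the other variables.  This
   is the recurrence; it implies the symmetry by induction, and the bounds on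
   the exponents hold for each configuration separately. *)

From HB Require Import structures.
Require Import Defs.
From mathcomp Require Import all_boot all_order all_fingroup all_algebra.
From mathcomp Require Import generic_quotient fraction mpoly.
From mathcomp Require Import boolp ring zify.
Set Implicit Arguments.
Unset Strict Implicit.
Unset Printing Implicit Defensive.
Import Order.TTheory GRing.Theory Num.Theory.
Local Open Scope ring_scope.

(** * Hecke operators on words and the Yang-Baxter equation *)

(** The Hecke algebra acts on functions of words by positions ([hecke]) and, for two consecutive
    letters that each occur once, by letters ([colour]). The two actions commute and agree at the
    word of [Theta]; this is the whole reason for the trace property, and it confines that property
    to the first n strands, since the letter of an empty edge is repeated. The product [Gs] has two
    duties. In the algebra, [T_k G_k = t] turns the residue-free part of the partial fraction
    expansion into a power of t. On the lattice, it carries the largest label to the front of the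
    final word, and so forces its path into the first column. The row parameters are [q^-1 x_i]. The
    crossings used to permute rows or columns see only ratios of parameters, so the same products in
    [x_j / x_i] serve for both, and [q^-1] can stay a free scalar [c] until the weights are
    compared. Once they have passed through the lattice, these products act on empty edges only,
    hence by the scalars [1 - t x_j / x_i] of the recurrence. *)

Lemma allW (U : Type) (a1 a2 : pred U) s :
  all a1 s -> (forall x, a1 x -> a2 x) -> all a2 s.
Proof. by move=> h h12; apply: sub_all h. Qed.

Definition word := nat -> nat.

Definition sw (k : nat) (w : word) : word :=
  fun p => w (if p == k then k.+1 else if p == k.+1 then k else p).

Lemma sw_l k w : sw k w k = w k.+1.
Proof. by rewrite /sw eqxx. Qed.
Lemma sw_r k w : sw k w k.+1 = w k.
Proof. by rewrite /sw eqxx ifN //; lia. Qed.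
Lemma sw_ne k w p : p <> k -> p <> k.+1 -> sw k w p = w p.
Proof. by rewrite /sw; do 2 case: eqP => //. Qed.
Lemma swK k : involutive (sw k).
Proof.
move=> w; apply/funext => p; rewrite /sw.
by do !case: eqP => //; move=> *; congr w; lia.
Qed.
Lemma sw_far j k w : (j.+1 < k)%N -> sw j (sw k w) = sw k (sw j w).
Proof.
move=> h; apply/funext => p; rewrite /sw.
by do !case: eqP => //; move=> *; congr w; lia.
Qed.

Definition up3 k a b c (w : word) : word :=
  fun p => if p == k then a else if p == k.+1 then b
           else if p == k.+2 then c else w p.
Lemma up3E k w : w = up3 k (w k) (w k.+1) (w k.+2) w.
Proof. by apply/funext => p; rewrite /up3; do !case: eqP => [->|] //. Qed.
Lemma sw_up3l k a b c w : sw k (up3 k a b c w) = up3 k b a c w.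
Proof.
apply/funext => p; rewrite /sw /up3.
by do !case: eqP => //; move=> *; lia.
Qed.
Lemma sw_up3r k a b c w : sw k.+1 (up3 k a b c w) = up3 k a c b w.
Proof.
apply/funext => p; rewrite /sw /up3.
by do !case: eqP => //; move=> *; lia.
Qed.
Lemma up3_0 k a b c w : up3 k a b c w k = a.
Proof. by rewrite /up3 eqxx. Qed.
Lemma up3_1 k a b c w : up3 k a b c w k.+1 = b.
Proof. by rewrite /up3 eqxx ifN //; lia. Qed.
Lemma up3_2 k a b c w : up3 k a b c w k.+2 = c.
Proof. by rewrite /up3 eqxx !ifN //; lia. Qed.

Section Hecke.
Variables (R : fieldType) (t : R).
Implicit Types (psi : word -> R) (w : word).

(* Acts on functions of words: [hecke k psi w] is the expected value of [psi]
   after one step from [w]; as an operator it satisfies (T - 1)(T + t) = 0. *)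
Definition hecke k psi : word -> R := fun w =>
  if (w k < w k.+1)%N then (1 - t) * psi w + t * psi (sw k w)
  else if (w k.+1 < w k)%N then psi (sw k w) else psi w.

Local Notation T := hecke.
Local Notation letter := (nat * (R * R))%type.
Definition letter_op (s : letter) psi : word -> R :=
  fun w => s.2.1 * T s.1 psi w + s.2.2 * psi w.
(* The leftmost letter is the first vertex met by the word. *)
Definition transfer (p : seq letter) psi := foldr letter_op psi p.
Local Notation lin := letter_op.
Local Notation run := transfer.

(* R_k(u) = (1 - u) T_k + (1 - t) u is the vertex weight, and G_k = t T_k^-1. *)
Definition Rl k u : letter := (k, (1 - u, (1 - t) * u)).
Definition Gl k : letter := (k, (1, t - 1)).
Definition Kl k c : letter := (k, (1, c)).

Lemma run_cat p q psi : run (p ++ q) psi = run p (run q psi).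
Proof. by rewrite /run foldr_cat. Qed.
Lemma run_cons s p psi : run (s :: p) psi = lin s (run p psi).
Proof. by []. Qed.

Lemma lin_far s s' psi : (s.1.+1 < s'.1)%N -> lin s (lin s' psi) = lin s' (lin s psi).
Proof.
case: s => k [a b]; case: s' => k' [a' b'] /= h; apply/funext => w.
have E1 v : sw k v k' = v k' by apply: sw_ne; lia.
have E2 v : sw k v k'.+1 = v k'.+1 by apply: sw_ne; lia.
have E3 v : sw k' v k = v k by apply: sw_ne; lia.
have E4 v : sw k' v k.+1 = v k.+1 by apply: sw_ne; lia.
rewrite /lin /= /T E1 E2 E3 E4 (sw_far _ h).
case: (ltngtP (w k) (w k.+1)) => _; case: (ltngtP (w k') (w k'.+1)) => _ /=;
by ring.
Qed.

Definition hecke_l (f : nat -> nat -> nat -> R) a b c :=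
  if (a < b)%N then (1 - t) * f a b c + t * f b a c
  else if (b < a)%N then f b a c else f a b c.
Definition hecke_r (f : nat -> nat -> nat -> R) a b c :=
  if (b < c)%N then (1 - t) * f a b c + t * f a c b
  else if (c < b)%N then f a c b else f a b c.

(** With all labels but three frozen, a relation between operators at k and k+1 becomes an identity
    for a function of three numbers, which [ring] settles for each relative order of a, b, c. *)
Definition at3 k w psi a b c : R := psi (up3 k a b c w).

Lemma at3_l k x y psi w : at3 k w (lin (k, (x, y)) psi) =
  fun a b c => x * hecke_l (at3 k w psi) a b c + y * at3 k w psi a b c.
Proof.
apply/funext=> a; apply/funext=> b; apply/funext=> c.
by rewrite /at3 /lin /T /= up3_0 up3_1 sw_up3l.
Qed.
Lemma at3_r k x y psi w : at3 k w (lin (k.+1, (x, y)) psi) =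
  fun a b c => x * hecke_r (at3 k w psi) a b c + y * at3 k w psi a b c.
Proof.
apply/funext=> a; apply/funext=> b; apply/funext=> c.
by rewrite /at3 /lin /T /= up3_1 up3_2 sw_up3r.
Qed.

Lemma yang_baxter k u v psi :
  run [:: Rl k u; Rl k.+1 (u * v); Rl k v] psi =
  run [:: Rl k.+1 v; Rl k (u * v); Rl k.+1 u] psi.
Proof.
apply/funext => w; rewrite (up3E k w).
move: (w k) (w k.+1) (w k.+2) => a b c.
rewrite -[LHS]/(at3 k w _ a b c) -[RHS]/(at3 k w _ a b c) /run /Rl /=.
rewrite !(at3_l, at3_r).
move: (at3 k w psi) => f; rewrite /hecke_l /hecke_r.
case: (ltngtP a b) => hab; case: (ltngtP b c) => hbc; case: (ltngtP a c) => hac.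
all: try by [exfalso; lia].
all: try subst; rewrite /= ?ltnn.
all: by ring.
Qed.

(** Conjugation by [G_k G_(k+1)] carries [T_k] to [T_(k+1)], as for the braid relation itself, hence
    carries any combination [x T_k + y] along. *)
Lemma G_braid k s psi :
  run [:: Gl k; Gl k.+1; (k, s)] psi = run [:: (k.+1, s); Gl k; Gl k.+1] psi.
Proof.
case: s => x y; apply/funext => w; rewrite (up3E k w).
move: (w k) (w k.+1) (w k.+2) => a b c.
rewrite -[LHS]/(at3 k w _ a b c) -[RHS]/(at3 k w _ a b c) /run /Gl /=.
rewrite !(at3_l, at3_r).
move: (at3 k w psi) => f; rewrite /hecke_l /hecke_r.
case: (ltngtP a b) => hab; case: (ltngtP b c) => hbc; case: (ltngtP a c) => hac.
all: try by [exfalso; lia].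
all: try subst; rewrite /= ?ltnn.
all: by ring.
Qed.

Lemma G_K k c psi w :
  lin (Gl k) (lin (Kl k c) psi) w = t * psi w + c * lin (Gl k) psi w.
Proof.
rewrite /lin /= /T sw_l sw_r swK.
by case: (ltngtP (w k) (w k.+1)) => _ /=; ring.
Qed.

Lemma K_G k psi w : lin (Kl k 0) (lin (Gl k) psi) w = t * psi w.
Proof.
rewrite /lin /= /T sw_l sw_r swK.
by case: (ltngtP (w k) (w k.+1)) => _ /=; ring.
Qed.

Lemma linD s f g w : lin s (fun w => f w + g w) w = lin s f w + lin s g w.
Proof.
case: s => k [a b]; rewrite /lin /= /T.
by case: (ltngtP (w k) (w k.+1)) => _ /=; ring.
Qed.

Lemma linZ s c f w : lin s (fun w => c * f w) w = c * lin s f w.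
Proof.
case: s => k [a b]; rewrite /lin /= /T.
by case: (ltngtP (w k) (w k.+1)) => _ /=; ring.
Qed.

Lemma lin_sum s (I : Type) (r : seq I) (c : I -> R) (F : I -> word -> R) w :
  lin s (fun w => \sum_(i <- r) c i * F i w) w = \sum_(i <- r) c i * lin s (F i) w.
Proof.
elim: r w => [|i r IH] w.
  have -> : (fun w => \sum_(i <- [::]) c i * F i w) = fun w => 0 * 0.
    by apply/funext => v; rewrite big_nil mul0r.
  by rewrite linZ mul0r big_nil.
rewrite big_cons -IH -linZ -linD; congr (lin _ _ _).
by apply/funext => v; rewrite big_cons.
Qed.

Lemma runZ p c f : run p (fun w => c * f w) = fun w => c * run p f w.
Proof.
by elim: p => //= s p ->; apply/funext => w; rewrite linZ.
Qed.

Lemma run_lin_far s p psi :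
  all (fun s' : letter => (s.1.+1 < s'.1)%N || (s'.1.+1 < s.1)%N) p ->
  lin s (run p psi) = run p (lin s psi).
Proof.
elim: p => //= s' p IH /andP[h /IH <-].
by case/orP: h => h; [exact: lin_far | apply: esym; exact: lin_far].
Qed.

Lemma run_far_cat a p q psi :
  all (fun s : letter => (s.1 < a)%N) p -> all (fun s : letter => (a < s.1)%N) q ->
  run p (run q psi) = run q (run p psi).
Proof.
move=> hp hq; elim: p hp => //= s p IH /andP[hs /IH ->].
by rewrite run_lin_far //; apply: (allW hq) => s' hs'; lia.
Qed.

Lemma run_ext (Q : word -> Prop) p f g :
  (forall w, Q w -> f w = g w) ->
  (forall s w, s \in map fst p -> Q w -> Q (sw s w)) ->
  forall w, Q w -> run p f w = run p g w.
Proof.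
move=> fg; elim: p => //= -[k [a b]] p IH H w Qw.
have {}IH : forall w, Q w -> run p f w = run p g w.
  by apply: IH => s v hs; apply: H; rewrite inE hs orbT.
by rewrite /lin /= /T !IH //; apply: H; rewrite ?inE ?eqxx.
Qed.

Lemma run0 p w : run p (fun _ => 0) w = 0.
Proof.
elim: p w => //= -[k [a b]] p IH w.
by rewrite /lin /= /T; case: ifP => _; [|case: ifP => _]; rewrite !IH; ring.
Qed.

Lemma run_vanish (Q : word -> Prop) p f :
  (forall w, Q w -> f w = 0) ->
  (forall s w, s \in map fst p -> Q w -> Q (sw s w)) ->
  forall w, Q w -> run p f w = 0.
Proof. by move=> h1 h2 w Qw; rewrite (run_ext h1 h2 Qw) run0. Qed.

(** The last entry, at the highest position, is met first: this is the order in which the vertices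
    of a column act, from the bottom upwards. *)
Fixpoint down (g : nat -> R -> letter) k (xs : seq R) : seq letter :=
  if xs is x :: xs' then down g k.+1 xs' ++ [:: g k x] else [::].

Lemma down_rcons g k xs x : down g k (rcons xs x) = g (k + size xs)%N x :: down g k xs.
Proof.
by elim: xs k => [|y xs IH] k /=; rewrite ?addn0 // IH /= addSnnS.
Qed.

Lemma down_pos g k xs : (forall k x, (g k x).1 = k) ->
  all (fun s => (k <= s.1 < k + size xs)%N) (down g k xs).
Proof.
move=> hg; elim: xs k => [|y xs IH] k //=.
rewrite all_cat /= hg andbT; apply/andP; split; last lia.
by apply: (allW (IH k.+1)) => s; lia.
Qed.

Definition grid_col k ys x := down (fun k y => Rl k (y / x)) k ys.
Fixpoint grid_row k y (xs : seq R) : seq letter :=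
  if xs is x :: xs' then Rl k (y / x) :: grid_row k.+1 y xs' else [::].
(* The rows [ys] are listed from top to bottom, but the bottom row acts first. *)
Fixpoint grid k (ys xs : seq R) : seq letter :=
  if ys is y :: ys' then grid k.+1 ys' xs ++ grid_row k y xs else [::].

Lemma col_cons k y ys x : grid_col k (y :: ys) x = grid_col k.+1 ys x ++ [:: Rl k (y / x)].
Proof. by []. Qed.
Lemma col_pos k ys x : all (fun s => (k <= s.1 < k + size ys)%N) (grid_col k ys x).
Proof. exact: down_pos. Qed.
Lemma row_pos k y xs : all (fun s => (k <= s.1 < k + size xs)%N) (grid_row k y xs).
Proof.
elim: xs k => //= x xs IH k; apply/andP; split; first lia.
by apply: (allW (IH k.+1)) => s; lia.
Qed.
Lemma grid_pos k ys xs : all (fun s => (k <= s.1)%N) (grid k ys xs).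
Proof.
elim: ys k => //= y ys IH k; rewrite all_cat; apply/andP; split.
  by apply: (allW (IH k.+1)) => s; lia.
by apply: (allW (row_pos k y xs)) => s; lia.
Qed.

(** The grid can also be read column by column: the first vertex of a row acts at distance at least
    two from the vertices strictly below it and to its right, so it slides past them. *)
Lemma grid_cons_col k ys x xs psi :
  run (grid k ys (x :: xs)) psi = run (grid_col k ys x) (run (grid k.+1 ys xs) psi).
Proof.
elim: ys k psi => //= y ys IH k psi.
rewrite run_cat IH col_cons !run_cat /=; congr run.
rewrite (@run_lin_far (Rl k (y / x))); last first.
  by apply: (allW (grid_pos k.+2 ys xs)) => s /=; lia.
by [].
Qed.

(** A crossing of the two rows travels from the left side to the right side, passing one column at a
    time by Yang-Baxter; the parameters fit because [y2 / x = (y2 / y1) * (y1 / x)]. *)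
Lemma row_exchange k y1 y2 xs psi : y1 != 0 ->
  run (Rl k (y2 / y1) :: grid_row k.+1 y2 xs ++ grid_row k y1 xs) psi =
  run (grid_row k.+1 y1 xs ++ grid_row k y2 xs ++ [:: Rl (k + size xs) (y2 / y1)]) psi.
Proof.
move=> y1n0; elim: xs k psi => [|x xs IH] k psi /=; first by rewrite addn0.
rewrite -(addSnnS k) !run_cat /= run_cat.
have far (y : R) : all (fun s' : letter => (k.+1 < s'.1)%N || (s'.1.+1 < k)%N) (grid_row k.+2 y xs).
  by apply: (allW (row_pos k.+2 y xs)) => s /=; lia.
rewrite -(@run_lin_far (Rl k (y1 / x))) //.
have e : y2 / x = (y2 / y1) * (y1 / x) by rewrite mulrA divfK.
have /= := yang_baxter k (y2 / y1) (y1 / x) (run (grid_row k.+2 y2 xs) (run (grid_row k.+1 y1 xs) psi)).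
rewrite -e => ->; congr lin.
have /= := IH k.+1 psi; rewrite !run_cat => ->.
by rewrite -(@run_lin_far (Rl k (y2 / x))).
Qed.

Lemma col_exchange k ys a x psi : a != 0 ->
  run (grid_col k ys a ++ grid_col k.+1 ys x ++ [:: Rl k (a / x)]) psi =
  run (Rl (k + size ys) (a / x) :: grid_col k ys x ++ grid_col k.+1 ys a) psi.
Proof.
move=> an0; elim: ys k psi => [|y ys IH] k psi; first by rewrite /= addn0.
rewrite !col_cons -(addSnnS k) !run_cat /= !run_cat /= .
have far z : all (fun s' : letter => (k.+1 < s'.1)%N || (s'.1.+1 < k)%N) (grid_col k.+2 ys z).
  by apply: (allW (col_pos k.+2 ys z)) => s /=; lia.
rewrite (@run_lin_far (Rl k (y / a))) //.
have e : y / x = (y / a) * (a / x) by rewrite mulrA divfK.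
have /= := yang_baxter k (y / a) (a / x) psi.
rewrite -e => ->.
have /= := IH k.+1 (lin (Rl k (y / x)) (lin (Rl k.+1 (y / a)) psi)).
rewrite !run_cat /= => ->; congr (lin _ (run _ _)).
by rewrite (@run_lin_far (Rl k (y / x))).
Qed.

(** Each letter of the column of crossings exchanges the row y with the row directly below it and
    comes out on the right; the rows above y act at positions too low to meet what comes out. *)
Lemma row_to_bottom k ys1 y ys2 xs psi : y != 0 ->
  run (grid_col (k + size ys1) ys2 y ++ grid k (ys1 ++ y :: ys2) xs) psi =
  run (grid k (ys1 ++ rcons ys2 y) xs ++ grid_col (k + size ys1 + size xs) ys2 y) psi.
Proof.
move=> yn0; elim: ys1 k psi => [|y1 ys1 IH] k psi /=; last first.
  rewrite -(addSnnS k) catA run_cat (IH k.+1) !run_cat; congr run.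
  apply: esym; apply: (@run_far_cat (k + size xs)).
    by apply: (allW (row_pos k y1 xs)) => s; lia.
  by apply: (allW (col_pos _ ys2 y)) => s; lia.
rewrite addn0; elim: ys2 k psi => [|y' ys IH] k psi; first by rewrite /= cats0.
rewrite !col_cons /= -!catA run_cat [RHS]run_cat /= !run_cat.
rewrite (@run_lin_far (Rl k (y' / y)) (grid k.+2 ys xs)); last first.
  by apply: (allW (grid_pos k.+2 ys xs)) => s /=; lia.
have /= := row_exchange k y' xs psi yn0; rewrite !run_cat /= => ->.
have /= := IH k.+1 (run (grid_row k y' xs) (lin (Rl (k + size xs) (y' / y)) psi)).
rewrite !run_cat => ->; congr run.
apply: esym; apply: (@run_far_cat (k + size xs)).
  by apply: (allW (row_pos k y' xs)) => s; lia.
by apply: (allW (col_pos _ ys y)) => s; lia.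
Qed.

Lemma col_to_front k ys xs1 x xs2 psi : all (fun a => a != 0) xs1 ->
  run (grid k ys (xs1 ++ x :: xs2) ++ grid_col k xs1 x) psi =
  run (grid_col (k + size ys) xs1 x ++ grid k ys (x :: xs1 ++ xs2)) psi.
Proof.
elim: xs1 k psi => [|a xs1 IH] k psi /=; first by rewrite cats0.
case/andP=> an0 h1.
rewrite run_cat [LHS]grid_cons_col.
have -> f : run (grid k.+1 ys (xs1 ++ x :: xs2)) (run (grid_col k (a :: xs1) x) f) =
   run (grid_col (k + size ys).+1 xs1 x) (run (grid k.+1 ys (x :: xs1 ++ xs2)) (lin (Rl k (a / x)) f)).
  rewrite col_cons run_cat /=.
  have /= := IH k.+1 (lin (Rl k (a / x)) f) h1; rewrite !run_cat => ->.
  by rewrite addSn.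
rewrite (@run_far_cat (k + size ys)); first last.
- by apply: (allW (col_pos _ xs1 x)) => s; lia.
- by apply: (allW (col_pos _ ys a)) => s; lia.
rewrite col_cons -catA run_cat; congr run.
rewrite grid_cons_col -(@run_lin_far _ (grid k.+2 ys (xs1 ++ xs2))); last first.
  by apply: (allW (grid_pos _ ys _)) => s /=; lia.
have /= := col_exchange k ys x (run (grid k.+2 ys (xs1 ++ xs2)) psi) an0.
by rewrite !run_cat /= => ->; rewrite [in RHS]grid_cons_col grid_cons_col.
Qed.

End Hecke.

(** * A partial fraction identity in the Hecke algebra *)

Section KeyIdentity.
Variables (R : fieldType) (t : R).
Implicit Types (psi : word -> R) (w : word) (xs : seq R).

Local Notation letter := (nat * (R * R))%type.
Local Notation lin := (letter_op t).
Local Notation run := (transfer t).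

(* R_k(x / z) / (1 - x / z) = T_k + kap x z *)
Definition kap x z := (1 - t) * x / (z - x).
Definition Kd k z xs := down (fun k x => Kl k (kap x z)) k xs.
Definition Gs m : seq letter := [seq Gl t k | k <- iota 0 m].

Arguments Gs : simpl never.
Arguments Kd : simpl never.

Lemma Kd_rcons k z xs x : Kd k z (rcons xs x) = Kl (k + size xs) (kap x z) :: Kd k z xs.
Proof. exact: down_rcons. Qed.
Lemma Kd_pos k z xs : all (fun s => (k <= s.1 < k + size xs)%N) (Kd k z xs).
Proof. exact: down_pos. Qed.

Lemma col_Kd k xs z psi : z != 0 -> z \notin xs ->
  run (grid_col t k xs z) psi = fun w => (\prod_(x <- xs) (1 - x / z)) * run (Kd k z xs) psi w.
Proof.
move=> z0; elim: xs k psi => [|x xs IH] k psi zxs.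
  by apply/funext => w; rewrite big_nil mul1r.
move: zxs; rewrite inE negb_or => /andP[zx zxs].
have -> : Kd k z (x :: xs) = Kd k.+1 z xs ++ [:: Kl k (kap x z)] by [].
rewrite col_cons !run_cat IH // big_cons; apply/funext => w.
have -> : run [:: Rl t k (x / z)] psi = fun w => (1 - x / z) * run [:: Kl k (kap x z)] psi w.
  apply/funext => v; rewrite /= /letter_op /= /kap.
  by field; rewrite ?z0 ?subr_eq0 ?zx.
by rewrite runZ; ring.
Qed.

Lemma lin_K k c psi w : lin (Kl k c) psi w = hecke t k psi w + c * psi w.
Proof. by rewrite /letter_op /= mul1r. Qed.

(* The residue at z = xs`_i of the product [Kd k z xs], up to a scalar: the
   i-th factor is removed and the others are evaluated at xs`_i. *)
Definition cut k xs (i : nat) : seq letter :=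
  Kd (k + i.+1) xs`_i (drop i.+1 xs) ++ Kd k xs`_i (take i xs).

Lemma cut_rcons k xs x i psi : (i < size xs)%N ->
  run (cut k (rcons xs x) i) psi =
  lin (Kl (k + size xs) (kap x xs`_i)) (run (cut k xs i) psi).
Proof.
move=> hi; rewrite /cut nth_rcons hi -cats1 drop_cat take_cat hi.
case: ltnP => hi' /=; last first.
  have e : size xs = i.+1 by lia.
  by rewrite e subnn /= drop_oversize ?e // /Kd /= addnS.
rewrite cats1 Kd_rcons /=; congr (lin (Kl _ _) _).
by rewrite size_drop; lia.
Qed.

Lemma cut_last k xs x : cut k (rcons xs x) (size xs) = Kd k x xs.
Proof.
rewrite /cut nth_rcons ltnn eqxx drop_oversize ?size_rcons //=.
by rewrite -cats1 take_size_cat.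
Qed.

(** As a function of z, the left side has simple poles at the entries of xs; the first term on the
    right is its value at infinity. When x is appended, the new residue is [Kd k x xs] itself, so
    the induction hypothesis is used at z and also at x. *)
Lemma partial_fractions k xs z psi w : uniq xs -> z \notin xs ->
  run (Kd k z xs) psi w = run (down (fun k _ => Kl k 0) k xs) psi w
   + \sum_(i <- iota 0 (size xs)) (1 - t) * xs`_i / (z - xs`_i) * run (cut k xs i) psi w.
Proof.
elim/last_ind: xs z w => [|xs x IH] z w; first by rewrite big_nil addr0.
rewrite rcons_uniq mem_rcons inE negb_or => /andP[xxs uxs] /andP[zx zxs].
rewrite Kd_rcons down_rcons /= !lin_K size_rcons -addn1 iotaD big_cat /= big_seq1 add0n.
rewrite cut_last nth_rcons ltnn eqxx.
have FE : run (Kd k z xs) psi = fun w => 1 * run (down (fun k _ => Kl k 0) k xs) psi w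
   + \sum_(i <- iota 0 (size xs)) (1 - t) * xs`_i / (z - xs`_i) * run (cut k xs i) psi w.
  by apply/funext => v; rewrite mul1r IH.
have TE : hecke t (k + size xs) (run (Kd k z xs) psi) w =
   hecke t (k + size xs) (run (down (fun k _ => Kl k 0) k xs) psi) w
   + \sum_(i <- iota 0 (size xs)) (1 - t) * xs`_i / (z - xs`_i)
       * hecke t (k + size xs) (run (cut k xs i) psi) w.
  have h f : hecke t (k + size xs) f = lin (Kl (k + size xs) 0) f.
    by apply/funext => v; rewrite lin_K mul0r addr0.
  rewrite !h FE linD linZ mul1r lin_sum; congr (_ + _).
  by apply: eq_bigr => i _; rewrite h.
rewrite TE (IH x) // (IH z) //.
have -> : \sum_(i <- iota 0 (size xs)) (1 - t) * (rcons xs x)`_i / (z - (rcons xs x)`_i)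
     * run (cut k (rcons xs x) i) psi w =
  \sum_(i <- iota 0 (size xs)) (1 - t) * xs`_i / (z - xs`_i)
       * hecke t (k + size xs) (run (cut k xs i) psi) w
  + \sum_(i <- iota 0 (size xs)) ((1 - t) * xs`_i / (z - xs`_i) * kap x xs`_i
       * run (cut k xs i) psi w).
  rewrite -big_split /= big_seq [RHS]big_seq; apply: eq_bigr => i.
  rewrite mem_iota add0n => /andP[_ hi].
  by rewrite cut_rcons // lin_K nth_rcons hi; ring.
rewrite mul0r addr0 -/(kap x z).
set S1 := \sum_(i <- _) _ / (z - _) * run _ _ _.
set S2 := \sum_(i <- _) _ / (x - _) * run _ _ _.
set S3 := \sum_(i <- _) _ * kap _ _ * _.
(* For each entry a of xs this is [1/((z-x)(z-a)) = 1/((z-a)(a-x)) + 1/((z-x)(x-a))]. *)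
suff E : kap x z * S1 = S3 + kap x z * S2 by rewrite !mulrDr E; ring.
rewrite !mulr_sumr -big_split /= big_seq [RHS]big_seq; apply: eq_bigr => i.
rewrite mem_iota add0n => /andP[_ hi].
have h1 : z - xs`_i != 0 by rewrite subr_eq0; apply: contraNneq zxs => ->; rewrite mem_nth.
have h2 : x - xs`_i != 0 by rewrite subr_eq0; apply: contraNneq xxs => ->; rewrite mem_nth.
have h3 : z - x != 0 by rewrite subr_eq0.
have h4 : xs`_i - x != 0 by rewrite -opprB oppr_eq0.
by rewrite /kap; field; rewrite ?h1 ?h2 ?h3 ?h4.
Qed.

Lemma Gs_S m : Gs m.+1 = Gs m ++ [:: Gl t m].
Proof. by rewrite /Gs -addn1 iotaD map_cat. Qed.

Lemma Gs_pos m : all (fun s => (s.1 < m)%N) (Gs m).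
Proof. by apply/allP => s /mapP[i]; rewrite mem_iota => hi ->. Qed.

Lemma Gs_shift m j s psi : (j.+1 < m)%N ->
  run (Gs m) (lin (j, s) psi) = lin (j.+1, s) (run (Gs m) psi).
Proof.
elim: m psi => // m IH psi; rewrite ltnS leq_eqVlt => /orP[/eqP <-|hj].
  rewrite !Gs_S -!catA !run_cat.
  have /= -> := G_braid t j s psi.
  rewrite (@run_lin_far _ _ (j.+1, s)) //.
  by apply: (allW (Gs_pos j)) => u /=; lia.
by rewrite Gs_S !run_cat /= -(@lin_far _ _ (j, s)) ?IH.
Qed.

Lemma Gs_shift_Kd m k z xs psi : (k + size xs < m)%N ->
  run (Gs m) (run (Kd k z xs) psi) = run (Kd k.+1 z xs) (run (Gs m) psi).
Proof.
elim/last_ind: xs => // xs x IH; rewrite size_rcons => h.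
by rewrite !Kd_rcons /= Gs_shift ?IH //; lia.
Qed.

Lemma down_Gs k xs psi :
  run (down (fun k _ => Kl k 0) k xs) (run [seq Gl t k | k <- iota k (size xs)] psi)
  = fun w => t ^+ size xs * psi w.
Proof.
elim: xs k psi => [|x xs IH] k psi; first by apply/funext => w; rewrite mul1r.
rewrite [LHS]/= run_cat /=.
have -> f : lin (Kl k 0) (lin (Gl t k) f) = fun w => t * f w.
  by apply/funext => w; rewrite K_G.
by rewrite runZ IH; apply/funext => w; rewrite mulrA exprS.
Qed.

(** Append x. In the old terms, [G_m (T_m + c) = t + c G_m] splits off t times the old identity and
    leaves a multiple of a residue of [Kd 0 x xs]. The new term, expanded in partial fractions at
    its own variable, supplies the opposite residues, and its residue-free part gives x times the
    power of t. *)
Lemma key_identity xs psi w : uniq xs ->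
  \sum_(i <- iota 0 (size xs)) xs`_i *
     run (Kd 0 xs`_i (take i xs) ++ Gs (size xs).-1 ++ Kd i xs`_i (drop i.+1 xs)) psi w
  = t ^+ (size xs).-1 * (\sum_(x <- xs) x) * psi w.
Proof.
elim/last_ind: xs => [|xs x IH]; first by rewrite !big_nil mulr0 mul0r.
rewrite rcons_uniq => /andP[xxs /[dup] uxs {}/IH IH].
rewrite size_rcons -addn1 iotaD big_cat /= big_seq1 add0n addn1 /=.
have -> : take (size xs) (rcons xs x) = xs by rewrite -cats1 take_size_cat.
rewrite drop_oversize ?size_rcons // cats0 nth_rcons ltnn eqxx.
have [->|[m em]] : xs = [::] \/ exists m, size xs = m.+1.
  by case: xs {xxs uxs IH} => [|y xs]; [left|right; exists (size xs)].
  by rewrite /= big_nil big_seq1 add0r expr0 mul1r.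
have -> : \sum_(i <- iota 0 (size xs)) (rcons xs x)`_i *
    run (Kd 0 (rcons xs x)`_i (take i (rcons xs x)) ++ Gs (size xs) ++
         Kd i (rcons xs x)`_i (drop i.+1 (rcons xs x))) psi w
  = \sum_(i <- iota 0 (size xs)) (t * (xs`_i *
     run (Kd 0 xs`_i (take i xs) ++ Gs (size xs).-1 ++ Kd i xs`_i (drop i.+1 xs)) psi w)
   + xs`_i * kap x xs`_i * run (cut 0 xs i) (run (Gs (size xs)) psi) w).
  rewrite big_seq [RHS]big_seq; apply: eq_bigr => i.
  rewrite mem_iota add0n => /andP[_ hi].
  rewrite nth_rcons hi -cats1 take_cat hi.
  have -> : Kd i xs`_i (drop i.+1 (xs ++ [:: x])) = Kl m (kap x xs`_i) :: Kd i xs`_i (drop i.+1 xs).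
    rewrite drop_cat; case: ltnP => hi'.
      by rewrite cats1 Kd_rcons size_drop; congr (Kl _ _ :: _); lia.
    have e : size xs = i.+1 by lia.
    by rewrite e subnn /= drop_oversize ?e // /Kd /=; congr [:: Kl _ _]; lia.
  have run_nil f : run [::] f = f by [].
  rewrite !run_cat em succnK Gs_S run_cat !run_cons !run_nil.
  set p := run (Kd i _ _) psi.
  have -> : lin (Gl t m) (lin (Kl m (kap x xs`_i)) p) = fun w => t * p w + kap x xs`_i * lin (Gl t m) p w.
    by apply/funext => v; rewrite G_K.
  set A := Kd 0 _ _.
  have runD q f g : run q (fun w => f w + g w) = fun w => run q f w + run q g w.
    by elim: q => //= s q ->; apply/funext => v; rewrite linD.
  rewrite runD !runZ runD !runZ mulrDr mulrCA; congr (_ + _); rewrite -mulrA; congr (_ * (_ * _)).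
  (* With [G_m] restored, the full product of inverse generators moves to the right through [Kd i]
     and raises its positions by one; this opens the gap between the two halves of [cut]. *)
  have -> : run (Gs m) (lin (Gl t m) p) = run (Gs m.+1) p by rewrite Gs_S run_cat.
  rewrite /p Gs_shift_Kd ?size_drop; last lia.
  rewrite -Gs_S add0n.
  rewrite (@run_far_cat _ _ i) //.
    by apply: (allW (Kd_pos _ _ _)) => s; rewrite size_takel; lia.
  by apply: (allW (Kd_pos _ _ _)) => s; lia.
rewrite big_split /= -mulr_sumr IH run_cat partial_fractions // down_Gs.
set S1 := \sum_(i <- _) _ * kap _ _ * _.
set S2 := \sum_(i <- _) _ / _ * _.
suff E : S1 + x * S2 = 0.
  rewrite mulrDr addrACA E big_rcons /= em /= exprS.
  by ring.
rewrite mulr_sumr -big_split /= big_seq big1 // => i.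
rewrite mem_iota add0n => /andP[_ hi].
have h2 : x - xs`_i != 0 by rewrite subr_eq0; apply: contraNneq xxs => ->; rewrite mem_nth.
have h4 : xs`_i - x != 0 by rewrite -opprB oppr_eq0.
by rewrite /kap; field; rewrite ?h2 ?h4.
Qed.

End KeyIdentity.

(** * The trace functional and the frozen lattice *)

Section Trace.
Variables (R : fieldType) (t : R).
Implicit Types (psi : word -> R) (v w : word) (xs : seq R).

Local Notation letter := (nat * (R * R))%type.
Local Notation lin := (letter_op t).
Local Notation run := (transfer t).
Local Notation T := (hecke t).

Definition delta v : word -> R := fun w => (`[< w = v >])%:R.
(* The labels 0, ..., n-1 of the paths, followed by empty edges, labelled n. *)
Definition idw n : word := fun p => minn p n.
Definition Theta n ys xs := run (grid t 0 ys xs) (delta (idw n)) (idw n).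

Lemma delta_id v : delta v v = 1.
Proof. by rewrite /delta asboolT. Qed.
Lemma delta_ne v w : w <> v -> delta v w = 0.
Proof. by move=> h; rewrite /delta asboolF. Qed.

Definition occ a w p q :=
  forall z, ((w z == a) = (z == p)) /\ ((w z == a.+1) = (z == q)).
Definition bef a w := `[< exists p q, occ a w p q /\ (p < q)%N >].
Definition colsw a w : word :=
  fun p => if w p == a then a.+1 else if w p == a.+1 then a else w p.
(* The Hecke generator exchanging the letters a and a.+1 instead of the
   positions k and k.+1; it commutes with the operators [hecke k]. *)
Definition colour a psi : word -> R := fun w =>
  if bef a w then (1 - t) * psi w + t * psi (colsw a w) else psi (colsw a w).

Lemma occ_bef a w p q : occ a w p q -> bef a w = (p < q)%N.
Proof.
move=> h; apply/asboolP/idP => [[p' [q' [h' lt]]]|lt]; last by exists p, q.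
have := h p' => -[]; have := h' p' => -[]; rewrite eqxx => -> _ /esym/eqP <- _.
by have := h q' => -[]; have := h' q' => -[] _; rewrite eqxx => -> _ /esym/eqP <-.
Qed.

Definition pos_sw k p := if p == k then k.+1 else if p == k.+1 then k else p.

Lemma occ_sw a k w p q : occ a w p q -> occ a (sw k w) (pos_sw k p) (pos_sw k q).
Proof.
move=> h z; rewrite /sw; have [-> ->] := h (if z == k then k.+1 else if z == k.+1 then k else z).
by rewrite /pos_sw; split; do !case: eqP => //; lia.
Qed.

Lemma occ_colsw a w p q : occ a w p q -> occ a (colsw a w) q p.
Proof.
move=> h z; rewrite /colsw; have [<- <-] := h z.
by split; do !case: eqP => //; lia.
Qed.

Lemma colswK a : involutive (colsw a).
Proof. by move=> w; apply/funext => p; rewrite /colsw; do !case: eqP => //; lia. Qed.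

Lemma colsw_sw a k w : colsw a (sw k w) = sw k (colsw a w).
Proof. by []. Qed.

(** If positions k and k+1 carry exactly the letters a and a+1, exchanging positions and exchanging
    letters give the same word. Otherwise neither exchange affects the comparison made by the
    other. *)
Lemma C_T a k psi w p q : occ a w p q -> colour a (T k psi) w = T k (colour a psi) w.
Proof.
move=> h; have hs := occ_sw k h; have hc := occ_colsw h; have hsc := occ_colsw hs.
have [hp _] := h p; have [_ hq] := h q; rewrite eqxx in hp; rewrite eqxx in hq.
move/eqP: hp => hp; move/eqP: hq => hq.
have npq : p <> q by move=> e; rewrite e hq in hp; lia.
have [[ek ek']|[[ek ek']|far]] : (p = k /\ q = k.+1) \/ (p = k.+1 /\ q = k) \/
    (pos_sw k p < pos_sw k q)%N = (p < q)%N /\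
    ~ ((p = k /\ q = k.+1) \/ (p = k.+1 /\ q = k)).
- by rewrite /pos_sw; do !case: eqP => //; lia.
- have e : colsw a w = sw k w.
    apply/funext => z; rewrite /colsw /sw; have [-> ->] := h z; rewrite ek ek'.
    by do !case: eqP => [?|?] //=; subst; congruence.
  have e' : colsw a (sw k w) = w by rewrite colsw_sw e swK.
  have b1 : bef a w by rewrite (occ_bef h); lia.
  have b2 : bef a (sw k w) = false by rewrite (occ_bef hs) /pos_sw; do !case: eqP => //; lia.
  rewrite ek in hp; rewrite ek' in hq.
  rewrite /colour /hecke e b1 b2 e' sw_l sw_r swK hp hq.
  by rewrite ltnSn ltnNge leqnSn /=; ring.
- have e : colsw a w = sw k w.
    apply/funext => z; rewrite /colsw /sw; have [-> ->] := h z; rewrite ek ek'.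
    by do !case: eqP => [?|?] //=; subst; try congruence; lia.
  have e' : colsw a (sw k w) = w by rewrite colsw_sw e swK.
  have b1 : bef a w = false by rewrite (occ_bef h); lia.
  have b2 : bef a (sw k w) by rewrite (occ_bef hs) /pos_sw; do !case: eqP => //; lia.
  rewrite ek in hp; rewrite ek' in hq.
  rewrite /colour /hecke e b1 b2 e' sw_l sw_r swK hp hq.
  by rewrite ltnSn [(a.+1 < a)%N]ltnNge leqnSn /=; ring.
case: far => far nbad.
have b : bef a (sw k w) = bef a w by rewrite (occ_bef h) (occ_bef hs).
have l : (colsw a w k < colsw a w k.+1)%N = (w k < w k.+1)%N.
  rewrite /colsw; have [h1 h2] := h k; have [h3 h4] := h k.+1.
  move: nbad; move: h1 h2 h3 h4; do !case: eqP => //; lia.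
have g : (colsw a w k.+1 < colsw a w k)%N = (w k.+1 < w k)%N.
  rewrite /colsw; have [h1 h2] := h k; have [h3 h4] := h k.+1.
  move: nbad; move: h1 h2 h3 h4; do !case: eqP => //; lia.
rewrite /colour /hecke l g b colsw_sw.
by case: (bef a w); case: (w k < w k.+1)%N; case: (w k.+1 < w k)%N => /=; ring.
Qed.

Lemma C_run a p psi w i j : occ a w i j -> colour a (run p psi) w = run p (colour a psi) w.
Proof.
elim: p w i j => // -[k [x y]] p IH w i j h.
rewrite !run_cons.
have -> : colour a (lin (k, (x, y)) (run p psi)) w =
    x * colour a (T k (run p psi)) w + y * colour a (run p psi) w.
  by rewrite /colour /letter_op /=; case: bef; ring.
rewrite (C_T _ _ h) (IH _ _ _ h) /letter_op /hecke /=.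
by rewrite (IH _ _ _ h) (IH _ _ _ (occ_sw k h)).
Qed.

Lemma C_delta a v w : colsw a v = sw a v -> (v a < v a.+1)%N -> bef a v ->
  colour a (delta v) w = T a (delta v) w.
Proof.
move=> cs va bv; have svv : sw a v <> v by move=> e; have := sw_l a v; rewrite e; lia.
rewrite /colour /hecke.
have [->|nv] := pselect (w = v); first by rewrite bv va cs.
have [->|nsv] := pselect (w = sw a v).
  rewrite -[in colsw _ _]cs colswK sw_l sw_r swK delta_id (delta_ne svv).
  rewrite va ltnNge ltnW //=; case: ifP => // /asboolP [p [q [h lt]]].
  have := occ_colsw h; rewrite -cs colswK => /occ_bef; rewrite bv; lia.
rewrite !(delta_ne nv).
have -> : delta v (sw a w) = 0 by apply: delta_ne => e; apply: nsv; rewrite -e swK.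
have -> : delta v (colsw a w) = 0.
  by apply: delta_ne => e; apply: nsv; rewrite -cs -e colswK.
by do !case: ifP => _; ring.
Qed.

Lemma occ_idw n a : (a.+1 < n)%N -> occ a (idw n) a a.+1.
Proof. by move=> h z; rewrite /idw; split; do !case: eqP => //; lia. Qed.

(* At the word [idw n], exchanging positions or letters is the same. *)
Lemma trace_T n k p : (k.+1 < n)%N ->
  T k (run p (delta (idw n))) (idw n) = run p (T k (delta (idw n))) (idw n).
Proof.
move=> kn; have h := occ_idw kn.
have cs : colsw k (idw n) = sw k (idw n).
  apply/funext => z; rewrite /colsw /sw /idw; do !case: eqP => //; lia.
have lt : (idw n k < idw n k.+1)%N by rewrite /idw; lia.
have b : bef k (idw n) by rewrite (occ_bef h).
have -> : T k (run p (delta (idw n))) (idw n) = colour k (run p (delta (idw n))) (idw n).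
  by rewrite /colour /hecke lt b cs.
rewrite (C_run _ _ h); congr (run _ _ _).
by apply/funext => w; apply: C_delta.
Qed.

Lemma trace n p q : all (fun s : letter => (s.1.+1 < n)%N) q ->
  run (q ++ p) (delta (idw n)) (idw n) = run (p ++ q) (delta (idw n)) (idw n).
Proof.
elim: q p => [|[k [x y]] q IH] p /=; first by rewrite cats0.
move=> /andP[kn hq].
rewrite {1}/letter_op /= trace_T //.
have -> : run (p ++ (k, (x, y)) :: q) (delta (idw n)) (idw n) =
   run (q ++ p ++ [:: (k, (x, y))]) (delta (idw n)) (idw n).
  by rewrite IH // -catA.
rewrite catA [in RHS]run_cat [run [:: _] _]/=.
have -> : lin (k, (x, y)) (delta (idw n)) =
   fun w => x * T k (delta (idw n)) w + y * delta (idw n) w by [].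
have runD r f g : run r (fun w => f w + g w) = fun w => run r f w + run r g w.
  by elim: r => //= s r ->; apply/funext => v; rewrite linD.
by rewrite runD !runZ.
Qed.

Lemma lin_eq k u psi w : w k = w k.+1 -> lin (Rl t k u) psi w = (1 - t * u) * psi w.
Proof. by rewrite /letter_op /hecke /= => ->; rewrite ltnn; ring. Qed.

Lemma lin_delta k u v : v k = v k.+1 ->
  lin (Rl t k u) (delta v) = fun w => (1 - t * u) * delta v w.
Proof.
move=> e; apply/funext => w.
have sv : sw k v = v by apply/funext => p; rewrite /sw; do 2 (case: eqP => [->|_] //).
rewrite /letter_op /hecke /=.
have [->|n] := pselect (w = v); first by rewrite e ltnn; ring.
have -> : delta v (sw k w) = 0 by apply: delta_ne => e'; apply: n; rewrite -[w](swK k) e'.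
by rewrite !(delta_ne n); do !case: ifP => _; ring.
Qed.

Lemma col_delta k xs z v : (forall p, (k <= p < k + size xs)%N -> v p = v p.+1) ->
  run (grid_col t k xs z) (delta v) = fun w => (\prod_(x <- xs) (1 - t * (x / z))) * delta v w.
Proof.
elim: xs k => [|x xs IH] k h; first by apply/funext => w; rewrite big_nil mul1r.
rewrite col_cons run_cat /= lin_delta; last by apply: h; rewrite /=; lia.
rewrite runZ IH => [|p hp]; last by apply: h; rewrite /=; lia.
by apply/funext => w; rewrite big_cons -mulrA.
Qed.

Lemma col_const k xs z psi w : (forall p, (k <= p < k + size xs)%N -> w p = w p.+1) ->
  run (grid_col t k xs z) psi w = (\prod_(x <- xs) (1 - t * (x / z))) * psi w.
Proof.
elim/last_ind: xs => [|xs x IH] h; first by rewrite big_nil mul1r.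
rewrite size_rcons in h.
rewrite /grid_col down_rcons run_cons lin_eq; last by apply: h; lia.
rewrite IH => [|p hp]; last by apply: h; lia.
by rewrite big_rcons /=; ring.
Qed.

Lemma row_const k y xs psi w : (forall p, (k <= p < k + size xs)%N -> w p = w p.+1) ->
  run (grid_row t k y xs) psi w = (\prod_(x <- xs) (1 - t * (y / x))) * psi w.
Proof.
elim: xs k => [|x xs IH] k h; first by rewrite big_nil mul1r.
rewrite /= lin_eq; last by apply: h; rewrite /=; lia.
by rewrite IH ?big_cons ?mulrA // => p hp; apply: h; rewrite /=; lia.
Qed.

Definition ins c j (w : word) : word :=
  fun p => if (p < j)%N then w p else if p == j then c else w p.-1.

Lemma sw_ins c j w : sw j (ins c j.+1 w) = ins c j w.
Proof.
apply/funext => p; rewrite /sw /ins.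
case: (p =P j) => [->|h1]; first by rewrite !ltnn !eqxx.
case: (p =P j.+1) => [->|h2]; do !case: ifP => ? //; lia.
Qed.

(** At an ascent of v the diagonal coefficient [1 - t] of [hecke] cancels the [t - 1] of [G_k], so
    the point mass moves without branching. This is why inverse generators, and not the generators,
    transport the largest label. *)
Lemma G_delta k v : (v k < v k.+1)%N -> lin (Gl t k) (delta v) = delta (sw k v).
Proof.
move=> lt; apply/funext => w; rewrite /letter_op /hecke /=.
have svv : sw k v <> v by move=> e; have := sw_l k v; rewrite e; lia.
have [->|n] := pselect (w = v).
  by rewrite lt delta_id !delta_ne //; [ring|move=> e; apply: svv].
have [->|n'] := pselect (w = sw k v).
  by rewrite sw_l sw_r swK lt ltnNge ltnW //= !delta_id delta_ne //; ring.
have -> : delta v (sw k w) = 0 by apply: delta_ne => e; apply: n'; rewrite -e swK.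
by rewrite !delta_ne //; do !case: ifP => _; ring.
Qed.

Lemma Gs_delta c j w : (forall p, (p < j)%N -> (w p < c)%N) ->
  run (Gs t j) (delta (ins c j w)) = delta (ins c 0 w).
Proof.
elim: j => // j IH h.
rewrite Gs_S run_cat -[run [:: _] _]/(lin _ _) G_delta ?sw_ins ?IH //.
  by move=> p hp; apply: h; lia.
by rewrite /ins ltnSn ltnn eqxx; apply: h.
Qed.

(** The label c comes from below the column and has to reach position 0, where phi is supported. If
    it turns right at some vertex, the remaining letters act at positions before it and never meet
    it; so it goes straight up, crossing smaller labels with weight [t * (1 - y / x)]. *)
Lemma col_frozen c ys x phi w : (forall v, v 0%N <> c -> phi v = 0) ->
  (forall p, (p < size ys)%N -> (w p < c)%N) ->
  run (grid_col t 0 ys x) phi (ins c (size ys) w) =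
  (\prod_(y <- ys) (t * (1 - y / x))) * phi (ins c 0 w).
Proof.
move=> hphi; elim/last_ind: ys => [|ys y IH] h; first by rewrite big_nil mul1r.
rewrite size_rcons in h *.
rewrite /grid_col down_rcons run_cons add0n -/(grid_col t 0 ys x) /letter_op /hecke /=.
have wj : (w (size ys) < c)%N by apply: h.
have -> : ins c (size ys).+1 w (size ys) = w (size ys) by rewrite /ins ltnSn.
have -> : ins c (size ys).+1 w (size ys).+1 = c by rewrite /ins ltnn eqxx.
rewrite wj sw_ins IH => [|p hp]; last by apply: h; lia.
rewrite (@run_vanish _ _ (fun v => forall p, (p <= size ys)%N -> v p <> c)).
- by rewrite big_rcons /=; ring.
- by move=> v hv; apply: hphi; apply: hv.
- move=> s v /mapP[s' hs' ->] hv p hp; rewrite /sw.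
  have := allP (col_pos t 0 ys x) _ hs'; rewrite add0n => hs.
  by move: hs => /= hs; do !case: eqP => ?; apply: hv; lia.
- by move=> p hp; rewrite /ins ltnS hp; have := h p hp; lia.
Qed.

Lemma lin_ins c k s psi w :
  lin (k.+1, s) psi (ins c 0 w) = lin (k, s) (fun v => psi (ins c 0 v)) w.
Proof.
rewrite /letter_op /hecke /=.
have -> : sw k.+1 (ins c 0 w) = ins c 0 (sw k w) => [|//].
apply/funext => -[|p]; rewrite /sw /ins //= !eqSS.
by case: (p == k) => //; case: (p == k.+1).
Qed.

Lemma row_ins c k y xs psi :
  (fun v => run (grid_row t k.+1 y xs) psi (ins c 0 v)) =
  run (grid_row t k y xs) (fun v => psi (ins c 0 v)).
Proof.
elim: xs k => //= x xs IH k; rewrite -IH; apply/funext => w.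
by rewrite lin_ins.
Qed.

Lemma grid_ins c k ys xs psi :
  (fun v => run (grid t k.+1 ys xs) psi (ins c 0 v)) =
  run (grid t k ys xs) (fun v => psi (ins c 0 v)).
Proof.
elim: ys k psi => //= y ys IH k psi; rewrite !run_cat -row_ins -IH.
by apply/funext => w; rewrite ?run_cat.
Qed.

(** The operators only compare labels, so they commute with any strictly monotone relabelling. *)
Lemma run_relabel (f : nat -> nat) p psi :
  (forall a b, (f a < f b)%N = (a < b)%N) ->
  (fun w => run p psi (f \o w)) = run p (fun w => psi (f \o w)).
Proof.
move=> hf; elim: p => //= s p <-; apply/funext => w.
by rewrite /letter_op /hecke /= !hf.
Qed.

Lemma delta_inj (f : word -> word) v : injective f ->
  (fun w => delta (f v) (f w)) = delta v.
Proof.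
move=> fi; apply/funext => w; rewrite /delta; congr (nat_of_bool _)%:R.
by apply: asbool_equiv_eq; split => [/fi|->].
Qed.

Lemma grid_rcons k ys y xs : grid t k (rcons ys y) xs = grid_row t (k + size ys) y xs ++ grid t k ys xs.
Proof.
elim: ys k => [|z ys IH] k /=; first by rewrite addn0 cats0.
by rewrite IH catA addSnnS.
Qed.

(* The path of largest label enters the bottom row and leaves the first column,
   so it must turn at the bottom left corner; removing the bottom grid_row and the
   first column leaves the lattice of size m. *)
Lemma frozen m ys xs x y : size ys = m -> size xs = m ->
  run (grid t 0 (rcons ys y) (x :: xs) ++ Gs t m) (delta (idw m.+1)) (idw m.+1) =
  (1 - t) * (\prod_(z <- ys) (t * (1 - z / x))) * (\prod_(z <- xs) (1 - t * (y / z)))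
   * Theta m ys xs.
Proof.
move=> sy sx.
pose w0 : word := fun p => if (p < m)%N then p else m.+1.
have idE : idw m.+1 = ins m m w0.
  apply/funext => p; rewrite /idw /ins /w0; case: ltnP => ?; first lia.
  by case: eqP => ?; first lia; case: ltnP; lia.
have w0m p : (p < m)%N -> (w0 p < m)%N by rewrite /w0 => h; rewrite h.
rewrite run_cat {1}idE Gs_delta // grid_rcons run_cat grid_cons_col add0n sy.
set phi := run (grid t 1 ys xs) _.
have phi0 v : v 0%N <> m -> phi v = 0.
  apply: (@run_vanish _ _ (fun v => v 0%N <> m)) => [{}v hv|s {}v /mapP[s' hs' ->] hv].
    by apply: delta_ne => e; apply: hv; rewrite e.
  have := allP (grid_pos t 1 ys xs) _ hs'; rewrite /sw /= => h.
  by rewrite ifN ?ifN //; lia.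
rewrite /= {1}/letter_op /hecke /=.
have -> : idw m.+1 m = m by rewrite /idw; lia.
have -> : idw m.+1 m.+1 = m.+1 by rewrite /idw; lia.
rewrite ltnSn.
(* This is the branch where the largest label goes right at the corner. It is then past position m;
   the rest of the row acts only beyond m and the column only up to m, so the label cannot reach
   position 0. *)
rewrite [run (grid_row _ _ _ _) _ (sw _ _)](@run_vanish _ _ (fun v => forall p, (p <= m)%N -> v p <> m)).
- rewrite row_const => [|p hp]; last by rewrite /idw; lia.
  have cf := @col_frozen m ys x phi w0 phi0; rewrite sy in cf.
  rewrite idE {}cf // {phi0}/phi.
  have -> : run (grid t 1 ys xs) (delta (ins m 0 w0)) (ins m 0 w0) = Theta m ys xs.
    have /(congr1 (fun f => f w0)) /= -> := grid_ins m 0 ys xs (delta (ins m 0 w0)).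
    rewrite (@delta_inj (ins m 0)); last first.
      by move=> v v' e; apply/funext => p; have := congr1 (fun f => f p.+1) e.
    (* An empty edge has label [m.+1] in the large lattice and m in the small one; [f] is the
       monotone relabelling that skips the removed path m. *)
    pose f a := if (a < m)%N then a else a.+1.
    have -> : w0 = f \o idw m.
      by apply/funext => p; rewrite /w0 /f /idw /=; do !case: ifP; lia.
    have hf a b : (f a < f b)%N = (a < b)%N by rewrite /f; do !case: ifP; lia.
    have /(congr1 (fun g => g (idw m))) /= -> := run_relabel (grid t 0 ys xs) (delta (f \o idw m)) hf.
    rewrite (@delta_inj (fun w => f \o w)) // => v v' e; apply/funext => p.
    have /= := congr1 (fun g => g p) e.
    by rewrite /f; do !case: ifP; lia.
  by ring.
- move=> v hv; apply: (@run_vanish _ _ (fun v => forall p, (p <= m)%N -> v p <> m)) => // [{hv}v hv|].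
    by apply: phi0; apply: hv.
  move=> s {hv}v /mapP[s' hs' ->] hv p hp; rewrite /sw.
  have := allP (col_pos t 0 ys x) _ hs'; rewrite /= add0n => hs.
  by do !case: eqP => ?; apply: hv; lia.
- move=> s v /mapP[s' hs' ->] hv p hp; rewrite /sw.
  have := allP (row_pos t m.+1 y xs) _ hs' => /= hs.
  by rewrite ifN ?ifN; [apply: hv| |]; lia.
- by move=> p hp; rewrite /sw /idw; do !case: eqP; lia.
Qed.

End Trace.

(** * The recurrence for the matrix elements *)

Section Recurrence.
Variables (R : fieldType) (t : R).
Implicit Types (psi : word -> R) (v w : word) (xs : seq R).

Local Notation letter := (nat * (R * R))%type.
Local Notation run := (transfer t).

Lemma col_scale c k xs z : c != 0 -> grid_col t k [seq c * x | x <- xs] (c * z) = grid_col t k xs z.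
Proof.
move=> c0; elim: xs k => //= x xs IH k; rewrite !col_cons IH; congr (_ ++ [:: Rl t k _]).
by rewrite invfM mulrACA divff ?mul1r.
Qed.

Lemma run_sum p (I : Type) (r : seq I) (a : I -> R) (F : I -> word -> R) w :
  run p (fun w => \sum_(i <- r) a i * F i w) w = \sum_(i <- r) a i * run p (F i) w.
Proof.
elim: p w => //= s p IH w; rewrite -lin_sum; congr (letter_op t s _ w).
by apply/funext => v; apply: IH.
Qed.

(** The factors [1 - x / z] clear the denominators of both [Kd] products and make them columns of
    crossings, to which the exchange lemmas apply. *)
Lemma Theta_term c m xs i : (i <= m)%N -> c != 0 -> 0 \notin xs -> uniq xs -> size xs = m.+1 ->
  let z := xs`_i in let os := take i xs ++ drop i.+1 xs in
  (\prod_(x <- os) (1 - x / z)) *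
   run (grid t 0 [seq c * x | x <- xs] xs ++ Kd t 0 z (take i xs) ++ Gs t m ++ Kd t i z (drop i.+1 xs))
    (delta R (idw m.+1)) (idw m.+1)
  = (\prod_(x <- os) (1 - t * (x / z))) * ((1 - t) * (\prod_(x <- os) (t * (1 - c * (x / z))))
     * (\prod_(x <- os) (1 - t * (c * (z / x))))
   * Theta t m [seq c * x | x <- os] os).
Proof.
move=> im c0 xs0 uxs sxs z os.
have zxs : z \in xs by rewrite mem_nth // sxs.
have z0 : z != 0 by apply: contraNneq xs0 => <-.
have xsE : xs = take i xs ++ z :: drop i.+1 xs.
  by rewrite -drop_nth ?cat_take_drop // sxs.
have := uxs; rewrite {1}xsE cat_uniq /= negb_or => /andP[_ /andP[/andP[zt _] /andP[zd _]]].
have st : size (take i xs) = i by rewrite size_takel // sxs; lia.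
have sd : size (drop i.+1 xs) = (m - i)%N by rewrite size_drop sxs; lia.
set tk := take i xs in xsE zt st os *; set dr := drop i.+1 xs in xsE zd sd os *.
have -> : run (grid t 0 [seq c * x | x <- xs] xs ++ Kd t 0 z tk ++ Gs t m ++ Kd t i z dr)
    (delta R (idw m.+1)) (idw m.+1) =
    run (Kd t i z dr ++ grid t 0 [seq c * x | x <- xs] xs ++ Kd t 0 z tk ++ Gs t m)
    (delta R (idw m.+1)) (idw m.+1).
  rewrite [RHS]trace -?catA //; apply: (allW (Kd_pos t i z dr)) => s; rewrite sd; lia.
rewrite big_cat /=.
pose G := run (Gs t m) (delta R (idw m.+1)).
have -> : \prod_(x <- tk) (1 - x / z) * \prod_(x <- dr) (1 - x / z) *
   run (Kd t i z dr ++ grid t 0 [seq c * x | x <- xs] xs ++ Kd t 0 z tk ++ Gs t m)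
     (delta R (idw m.+1)) (idw m.+1) =
   run (grid_col t i dr z) (run (grid t 0 [seq c * x | x <- xs] xs) (run (grid_col t 0 tk z) G)) (idw m.+1).
  by rewrite col_Kd // col_Kd // !runZ !run_cat -/G; ring.
pose ys1 := [seq c * x | x <- tk]; pose ys2 := [seq c * x | x <- dr].
have ysE : [seq c * x | x <- xs] = ys1 ++ (c * z) :: ys2 by rewrite xsE map_cat.
rewrite -(col_scale i dr z c0) ysE.
have := row_to_bottom t 0 ys1 ys2 xs (run (grid_col t 0 tk z) G) (mulf_neq0 c0 z0).
rewrite add0n size_map st !run_cat => ->.
rewrite sxs col_scale //.
(* Having come out on the right, the crossings act at positions from [i + m.+1] on, so they commute
   with everything that is left and reach the final word where all labels are equal. *)
have -> : run (grid_col t (i + m.+1) dr z) (run (grid_col t 0 tk z) G) =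
  fun w => (\prod_(x <- dr) (1 - t * (x / z))) * run (grid_col t 0 tk z) G w.
  have h1 : all (fun s => (s.1 < i)%N) (grid_col t 0 tk z).
    by apply: (allW (col_pos t _ tk z)) => s; lia.
  have h2 a : (a < i + m.+1)%N -> all (fun s => (a < s.1)%N) (grid_col t (i + m.+1) dr z).
    by move=> ha; apply: (allW (col_pos t _ dr z)) => s; lia.
  rewrite -(@run_far_cat _ t i _ (grid_col t (i + m.+1) dr z) _ h1) ?h2 /G; try lia.
  rewrite -(@run_far_cat _ t m (Gs t m) (grid_col t (i + m.+1) dr z)) ?h2 ?Gs_pos; try lia.
  by rewrite col_delta ?runZ // => p hp; rewrite /idw; lia.
rewrite runZ xsE.
have tk0 : all (fun a => a != 0) tk.
  by apply/allP => a /mem_take ha; apply: contraNneq xs0 => <-.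
have := col_to_front t 0 (ys1 ++ rcons ys2 (c * z)) z dr G tk0.
rewrite !run_cat => ->.
(* The other column of crossings has come out in front of the grid, again at positions of the
   initial word that hold only empty edges. *)
rewrite col_const; last first.
  by move=> p; rewrite size_cat size_rcons !size_map st sd /idw; lia.
rewrite -rcons_cat /G -run_cat frozen; last first.
- by rewrite size_cat st sd; lia.
- by rewrite size_cat !size_map st sd; lia.
rewrite /os map_cat [\prod_(x <- tk ++ dr) (1 - t * (x / z))]big_cat /=.
rewrite -map_cat big_map.
have -> : \prod_(x <- tk ++ dr) (t * (1 - c * x / z)) = \prod_(x <- tk ++ dr) (t * (1 - c * (x / z))).
  by apply: eq_bigr => x _; rewrite mulrA.
have -> : \prod_(x <- tk ++ dr) (1 - t * (c * z / x)) = \prod_(x <- tk ++ dr) (1 - t * (c * (z / x))).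
  by apply: eq_bigr => x _; rewrite -[c * z / x]mulrA.
by ring.
Qed.

Lemma Theta_recurrence c m xs : c != 0 -> 0 \notin xs -> uniq xs -> size xs = m.+1 ->
  t ^+ m * (\sum_(x <- xs) x) * Theta t m.+1 [seq c * x | x <- xs] xs =
  \sum_(i <- iota 0 m.+1)
    xs`_i * ((1 - t) * Theta t m [seq c * x | x <- take i xs ++ drop i.+1 xs] (take i xs ++ drop i.+1 xs)
    * \prod_(x <- take i xs ++ drop i.+1 xs)
       ((1 - t * (x / xs`_i)) * (t * (1 - c * (x / xs`_i))) * (1 - t * (c * (xs`_i / x)))
         / (1 - x / xs`_i))).
Proof.
move=> c0 xs0 uxs sxs.
have := @key_identity _ t xs (delta R (idw m.+1)) _ uxs; rewrite sxs /= => key.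
have keyf : (fun w => t ^+ m * (\sum_(x <- xs) x) * delta R (idw m.+1) w) =
  (fun w => \sum_(i <- iota 0 m.+1) xs`_i *
     run (Kd t 0 xs`_i (take i xs) ++ Gs t m ++ Kd t i xs`_i (drop i.+1 xs)) (delta R (idw m.+1)) w).
  by apply/funext => w; rewrite key.
rewrite /Theta.
have /(congr1 (fun f => f (idw m.+1))) := runZ t (grid t 0 [seq c * x | x <- xs] xs)
   (t ^+ m * (\sum_(x <- xs) x)) (delta R (idw m.+1)).
rewrite keyf run_sum => <-.
rewrite big_seq [RHS]big_seq; apply: eq_bigr => i.
rewrite mem_iota add0n => /andP[_ im]; congr (_ * _).
have := Theta_term (im : (i <= m)%N) c0 xs0 uxs sxs; rewrite /= -run_cat.
set z := xs`_i; set os := take i xs ++ _.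
have nz : \prod_(x <- os) (1 - x / z) != 0.
  rewrite prodf_seq_neq0; apply/allP => x xos /=.
  have zxs : z \in xs by rewrite mem_nth // sxs.
  have z0 : z != 0 by apply: contraNneq xs0 => <-.
  rewrite subr_eq0 eq_sym; apply/eqP => /divr1_eq e; move: uxs.
  have -> : xs = take i xs ++ z :: drop i.+1 xs.
    by rewrite -drop_nth ?cat_take_drop // sxs.
  by rewrite -cat1s uniq_catCA cons_uniq -e xos.
rewrite !big_split /= prodfV => e.
apply: (mulfI nz); rewrite {}e /Theta; field.
exact: nz.
Qed.

End Recurrence.

(** * Partition functions as matrix elements *)

Section Transfer.
Variables (R : fieldType) (t : R) (n : nat).

Local Notation run := (transfer t).
Local Notation E := (edge n).
Local Notation L := 'I_n.+1.
Local Notation config := {ffun edge n -> 'I_n.+1}.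
Local Notation vertex := ('I_n * 'I_n)%type.

(** Unlike [vertex_weight], whose last branch is a catch-all, this weight vanishes unless labels are
    conserved, so the labels of the outgoing edges can be summed over freely. *)
Definition ice (y : R) (l d u r : nat) : R :=
  if (l == u) && (d == r) then
    if (l < d)%N then 1 - t else if (d < l)%N then y * (1 - t) else 1 - t * y
  else if (l == r) && (d == u) then
    if (l < d)%N then t * (1 - y) else 1 - y
  else 0.

Lemma ice_ne y l d u r : ~ ((u = l /\ r = d) \/ (u = d /\ r = l)) -> ice y l d u r = 0.
Proof.
by rewrite /ice => h; case: ifP => [/andP[/eqP a /eqP b]|_];
  [case: h; left|case: ifP => [/andP[/eqP a /eqP b]|//]; case: h; right].
Qed.

Definition set2 k u r (w : word) : word :=
  fun p => if p == k then u else if p == k.+1 then r else w p.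

Lemma set2_id k w : set2 k (w k) (w k.+1) w = w.
Proof. by apply/funext => p; rewrite /set2; do 2 (case: eqP => [->|_] //). Qed.
Lemma set2_sw k w : set2 k (w k.+1) (w k) w = sw k w.
Proof. by apply/funext => p; rewrite /set2 /sw; do 2 case: eqP => // _. Qed.

(** Conservation leaves the pair of incoming labels, unchanged or exchanged: these are the diagonal
    and the exchange terms of [R_k(y)], which merge when the two labels are equal. *)
Lemma ice_sum k y (psi : word -> R) w : (w k <= n)%N -> (w k.+1 <= n)%N ->
  \sum_(p : L * L) ice y (w k) (w k.+1) p.1 p.2 * psi (set2 k p.1 p.2 w) =
  letter_op t (Rl t k y) psi w.
Proof.
move=> hl hd; pose l : L := Ordinal (hl : (w k < n.+1)%N).
pose d : L := Ordinal (hd : (w k.+1 < n.+1)%N).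
rewrite (bigD1 (l, d)) //= set2_id {1}/ice !eqxx /=.
have [e|ne] := eqVneq (w k) (w k.+1).
  rewrite big1 ?addr0 => [|[u r] /= h].
    by rewrite e ltnn lin_eq.
  rewrite ice_ne ?mul0r // => -[] [hu hr]; case/negP: h; apply/eqP; congr (_, _);
    by apply: val_inj; rewrite /= ?hu ?hr.
rewrite (bigD1 (d, l)) /=; last first.
  by apply: contra_neq ne => -[e _]; rewrite e.
rewrite set2_sw {1}/ice (negPf ne) eqxx [w k.+1 == _]eq_sym (negPf ne) /=.
rewrite eqxx big1 ?addr0 => [|[u r] /= /andP[h h']]; last first.
  rewrite ice_ne ?mul0r // => -[] [hu hr]; [case/negP: h|case/negP: h']; apply/eqP;
    by congr (_, _); apply: val_inj; rewrite /= ?hu ?hr.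
rewrite /letter_op /hecke /=.
by case: (ltngtP (w k) (w k.+1)) ne => //= _ _; ring.
Qed.

(* The vertex (i, j) acts at the positions i + j and i + j + 1 of the word of
   labels read along a lattice path from the top left to the bottom right
   corner; [None] stands for the positions beyond this path. *)
Definition diag (v : vertex) : nat := (v.1 + v.2)%N.
Definition frontier := nat -> option E.
Definition word_of (c : config) (F : frontier) : word :=
  fun p => if F p is Some e then c e : nat else n.
Definition top_right (v : vertex) : seq E := [:: edge_top v.1 v.2; edge_right v.1 v.2].
Definition created (vs : seq vertex) : seq E := flatten [seq top_right v | v <- vs].
Definition step (F : frontier) (v : vertex) : frontier := fun p =>
  if p == diag v then Some (edge_top v.1 v.2)
  else if p == (diag v).+1 then Some (edge_right v.1 v.2) else F p.
Fixpoint sched (F : frontier) (vs : seq vertex) : Prop :=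
  if vs is v :: vs' then
    [/\ F (diag v) = Some (edge_left v.1 v.2),
        F (diag v).+1 = Some (edge_bottom v.1 v.2) & sched (step F v) vs']
  else True.
Definition cice (y : vertex -> R) (c : config) (v : vertex) : R :=
  ice (y v) (c (edge_left v.1 v.2)) (c (edge_bottom v.1 v.2))
      (c (edge_top v.1 v.2)) (c (edge_right v.1 v.2)).

Lemma sched_cat F vs vs' : sched F (vs ++ vs') <-> sched F vs /\ sched (foldl step F vs) vs'.
Proof.
elim: vs F => [|v vs IH] F /=; first by split=> [|[]].
by split=> [[h1 h2 /IH[h3 h4]]|[[h1 h2 h3] h4]]; [split | split=> //; apply/IH].
Qed.

(* Summing first over the labels of the edges leaving the first vertex. *)
Lemma sched_sum (y : vertex -> R) vs F (c0 : config) psi :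
  sched F vs -> uniq (created vs) ->
  (forall p e, F p = Some e -> e \notin created vs) ->
  \sum_(c : config | [forall e, (e \in created vs) || (c e == c0 e)])
     (\prod_(v <- vs) cice y c v) * psi (word_of c (foldl step F vs)) =
  run [seq Rl t (diag v) (y v) | v <- vs] psi (word_of c0 F).
Proof.
elim: vs F c0 => [|v vs IH] F c0.
  move=> _ _ _; rewrite (big_pred1 c0) => [|c]; first by rewrite big_nil mul1r.
  apply/forallP/eqP => [h|-> e]; last by rewrite eqxx orbT.
  by apply/ffunP => e; have := h e; rewrite in_nil => /eqP.
have cE : created (v :: vs) = edge_top v.1 v.2 :: edge_right v.1 v.2 :: created vs by [].
case=> hl hd hs; rewrite cE !cons_uniq => /and3P[].
rewrite inE negb_or => /andP[_ ut] ur ucr hF.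
rewrite (partition_big (fun c : config => (c (edge_top v.1 v.2), c (edge_right v.1 v.2))) predT) //=.
have /= := @ice_sum (diag v) (y v) (run [seq Rl t (diag v) (y v) | v <- vs] psi) (word_of c0 F).
have le (e : option E) : ((if e is Some e then c0 e : nat else n) <= n)%N.
  by case: e => // e; rewrite -ltnS.
move=> <-; try exact: le.
apply: eq_bigr => -[u r] _.
pose c1 : config := [ffun e => if e == edge_top v.1 v.2 then u
   else if e == edge_right v.1 v.2 then r else c0 e].
have nF p e : F p = Some e -> [/\ e != edge_top v.1 v.2, e != edge_right v.1 v.2 & e \notin created vs].
  by move=> /hF; rewrite !inE !negb_or => /and3P[].
have hF1 p e : step F v p = Some e -> e \notin created vs.
  rewrite /step; case: eqP => _; first by case=> <-.
  case: eqP => _; first by case=> <-.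
  by case/nF.
have wE : set2 (diag v) u r (word_of c0 F) = word_of c1 (step F v).
  apply/funext => p; rewrite /set2 /word_of /step.
  case: eqP => _; first by rewrite ffunE eqxx.
  case: eqP => _; first by rewrite ffunE eqxx.
  case Fp: (F p) => [e|] //; have [h1 h2 _] := nF _ _ Fp.
  by rewrite ffunE (negPf h1) (negPf h2).
rewrite /= wE -IH // mulr_sumr; apply: eq_big => [c|c].
  apply/idP/forallP => [/andP[/forallP h /eqP[h1 h2]] e|h].
    have := h e; rewrite !inE ffunE; case: eqP => [->|_]; first by rewrite h1 eqxx orbT.
    by case: eqP => [->|_]; first by rewrite h2 eqxx orbT.
  apply/andP; split; last first.
    have := h (edge_top v.1 v.2); have := h (edge_right v.1 v.2).
    by rewrite (negPf ut) (negPf ur) !ffunE !eqxx /= => /eqP -> /eqP ->.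
  apply/forallP => e; have := h e; rewrite !inE ffunE.
  by case: (e =P edge_top v.1 v.2) => //= _; case: (e =P edge_right v.1 v.2).
case/andP=> /forallP h /eqP[h1 h2].
rewrite big_cons -mulrA; congr (_ * _).
have [l1 l2 l3] := nF _ _ hl; have [d1 d2 d3] := nF _ _ hd.
rewrite /cice /word_of hl hd h1 h2.
have := h (edge_left v.1 v.2); have := h (edge_bottom v.1 v.2).
rewrite !inE (negPf l1) (negPf l2) (negPf l3) (negPf d1) (negPf d2) (negPf d3) /=.
by move=> /eqP -> /eqP ->.
Qed.

End Transfer.

(** * Processing the grid row by row, from the bottom row upwards *)

Section Schedule.
Variables (R : fieldType) (t : R) (n : nat).

Local Notation run := (transfer t).
Local Notation E := (edge n).
Local Notation L := 'I_n.+1.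
Local Notation config := {ffun edge n -> 'I_n.+1}.
Local Notation vertex := ('I_n * 'I_n)%type.

Definition hedge (i k : nat) : option E :=
  obind (fun i' : 'I_n => omap (fun k' : 'I_n.+1 => inl (i', k') : E) (insub k)) (insub i).
Definition vedge (k j : nat) : option E :=
  obind (fun k' : 'I_n.+1 => omap (fun j' : 'I_n => inr (k', j') : E) (insub j)) (insub k).

Lemma hedgeE (i : 'I_n) (k : 'I_n.+1) (p q : nat) : p = i -> q = k -> hedge p q = Some (inl (i, k)).
Proof. by move=> -> ->; rewrite /hedge !valK. Qed.
Lemma vedgeE (k : 'I_n.+1) (j : 'I_n) (p q : nat) : p = k -> q = j -> vedge p q = Some (inr (k, j)).
Proof. by move=> -> ->; rewrite /vedge !valK. Qed.
Lemma hedge_out i k : (n <= i)%N -> hedge i k = None.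
Proof.
by rewrite leqNgt => h; rewrite /hedge; case: (insubP 'I_n i) => [u hu _|]; [rewrite hu in h|].
Qed.

(** The lattice path that goes down the left side to level i, along that level, and down the right
    side. For i = n it is the left and bottom boundary, for i = 0 the top and right boundary. *)
Definition row_frontier (i : nat) : frontier n := fun p =>
  if (p < i)%N then hedge p 0 else if (p < i + n)%N then vedge i (p - i) else hedge (p - n) n.
(** The state after j vertices of row i: the path drops from level i to level [i.+1] along the
    horizontal edge at position [i + j]. *)
Definition mid_frontier (i j : nat) : frontier n := fun p =>
  if (p < i)%N then hedge p 0 else if (p < i + j)%N then vedge i (p - i)
  else if p == (i + j)%N then hedge i j
  else if (p <= i + n)%N then vedge i.+1 (p - i.+1) else hedge (p - n) n.

Lemma mid_frontier0 i : mid_frontier i 0 = row_frontier i.+1.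
Proof.
apply/funext => p; rewrite /mid_frontier /row_frontier addn0.
have [h|[h|h]] : (p < i)%N \/ p = i \/ (i < p)%N by lia.
- by rewrite h ltnS (ltnW h).
- by rewrite h ltnn eqxx ltnSn.
by repeat (case: ifP => ?); try by []; exfalso; lia.
Qed.

Lemma mid_frontiern i : mid_frontier i n = row_frontier i.
Proof.
apply/funext => p; rewrite /mid_frontier /row_frontier.
case: ltnP => // h1; case: ltnP => // h2; case: eqP => [->|h3]; first by rewrite addnK.
by rewrite ifN //; lia.
Qed.

Lemma step_mid (i j : 'I_n) : step (mid_frontier i j) (i, j) = mid_frontier i j.+1.
Proof.
apply/funext => p; rewrite /step /mid_frontier /diag /=.
have := ltn_ord j; move=> hj.
case: eqP => [->|h1].
  have -> : (i + j < i)%N = false by lia.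
  have -> : (i + j < i + j.+1)%N by lia.
  by rewrite addKn (@vedgeE (widen_ord (leqnSn n) i) j).
case: eqP => [->|h2].
  have -> : ((i + j).+1 < i)%N = false by lia.
  have -> : ((i + j).+1 < i + j.+1)%N = false by lia.
  by rewrite addnS eqxx (@hedgeE i (lift ord0 j)).
case: ltnP => // h3.
have -> : (p < i + j.+1)%N = (p < i + j)%N by lia.
case: ltnP => // h4; have -> : (p == i + j.+1)%N = false by lia.
by [].
Qed.

Definition row_vertices (i : 'I_n) : seq vertex := [seq (i, j) | j <- enum 'I_n].

Lemma row_sched (i : 'I_n) :
  sched (row_frontier i.+1) (row_vertices i) /\
  foldl (@step n) (row_frontier i.+1) (row_vertices i) = row_frontier i.
Proof.
suff H m j : (j + m)%N = n ->
    sched (mid_frontier i j) [seq (i, j') | j' <- drop j (enum 'I_n)] /\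
    foldl (@step n) (mid_frontier i j) [seq (i, j') | j' <- drop j (enum 'I_n)] = mid_frontier i n.
  by have := H n 0%N (add0n _); rewrite mid_frontier0 mid_frontiern drop0.
elim: m j => [|m IH] j e.
  by have -> : j = n :> nat; [lia|rewrite drop_oversize ?size_enum_ord].
have hj : (j < n)%N by lia.
rewrite (drop_nth (Ordinal hj)) ?size_enum_ord //.
have -> : nth (Ordinal hj) (enum 'I_n) j = Ordinal hj.
  by apply: val_inj; rewrite /= nth_enum_ord.
have [IH1 IH2] := IH j.+1 ltac:(lia).
have sE : step (mid_frontier i j) (i, Ordinal hj) = mid_frontier i j.+1 by exact: (step_mid i (Ordinal hj)).
rewrite /= sE; split=> //; split=> //; rewrite /mid_frontier /diag /=.
  rewrite ifN ?ltnNge ?leq_addr // eqxx.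
  by rewrite ifN ?ltnNge ?leqnn //; apply: hedgeE.
do 3 (rewrite ifN; last lia).
by rewrite ifT; [apply: vedgeE; rewrite /= /bump /=|]; lia.
Qed.

Definition all_vertices : seq vertex := flatten [seq row_vertices i | i <- rev (enum 'I_n)].

Lemma all_sched :
  sched (row_frontier n) all_vertices /\ foldl (@step n) (row_frontier n) all_vertices = row_frontier 0.
Proof.
suff H m : (m <= n)%N ->
    sched (row_frontier m) (flatten [seq row_vertices i | i <- rev (take m (enum 'I_n))]) /\
    foldl (@step n) (row_frontier m) (flatten [seq row_vertices i | i <- rev (take m (enum 'I_n))])
      = row_frontier 0.
  by have := H n (leqnn n); rewrite take_oversize ?size_enum_ord.
elim: m => [|m IH] hm; first by rewrite take0.
rewrite (take_nth (Ordinal hm)) ?size_enum_ord // rev_rcons /=.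
have -> : nth (Ordinal hm) (enum 'I_n) m = Ordinal hm.
  by apply: val_inj; rewrite /= nth_enum_ord.
have [r1 r2] := row_sched (Ordinal hm); have [IH1 IH2] := IH (ltnW hm).
by rewrite foldl_cat r2; split=> //; apply/sched_cat; rewrite r2.
Qed.

Lemma mem_all_vertices v : v \in all_vertices.
Proof.
case: v => i j; apply/flattenP; exists (row_vertices i).
  by apply/mapP; exists i; rewrite ?mem_rev ?mem_enum.
by apply/mapP; exists j; rewrite ?mem_enum.
Qed.

Lemma uniq_all_vertices : uniq all_vertices.
Proof.
have -> : all_vertices = [seq (i, j) | i <- rev (enum 'I_n), j <- enum 'I_n] by [].
by apply: allpairs_uniq; rewrite ?rev_uniq ?enum_uniq // => -[a b] [c d] _ _ [-> ->].
Qed.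

Lemma mem_created (vs : seq vertex) e :
  reflect (exists2 v, v \in vs & e = edge_top v.1 v.2 \/ e = edge_right v.1 v.2) (e \in created vs).
Proof.
apply: (iffP flattenP) => [[s /mapP[v hv ->]]|[v hv he]].
  by rewrite !inE => /orP[]/eqP ->; exists v; auto.
exists (top_right v); first exact: map_f.
by rewrite !inE; case: he => ->; rewrite eqxx ?orbT.
Qed.

Lemma uniq_created (vs : seq vertex) : uniq vs -> uniq (created vs).
Proof.
elim: vs => // -[i j] vs IH; rewrite cons_uniq => /andP[hv /IH u].
rewrite -[created _]/(edge_top i j :: edge_right i j :: created vs) !cons_uniq u andbT.
rewrite inE; apply/andP; split.
  apply/mem_created => -[[i' j'] hv' /= [[ei ej]|//]]; have {}ei : i = i' by apply: val_inj.
  by rewrite ei ej hv' in hv.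
apply/mem_created => -[[i' j'] hv' /= [//|[ei ej]]].
have {}ej : j = j' by apply: val_inj; move: ej; rewrite /= /bump /=; lia.
by rewrite ei ej hv' in hv.
Qed.

Lemma edge_cases (e : E) : [\/ exists i, e = ext_left i, exists j, e = ext_bottom j
  | e \in created all_vertices].
Proof.
case: e => -[].
  move=> i k; case: (unliftP ord0 k) => [j ->|->]; last by constructor 1; exists i.
  constructor 3; apply/mem_created; exists (i, j); first exact: mem_all_vertices.
  by right.
move=> k j; have [hk|hk] := ltnP k n.
  constructor 3; apply/mem_created; exists (Ordinal hk, j); first exact: mem_all_vertices.
  by left; congr (inr (_, _)); apply: val_inj.
constructor 2; exists j; congr (inr (_, _)); apply: val_inj => /=.
by have := ltn_ord k; lia.
Qed.

Lemma ext_left_created i : (ext_left i : E) \notin created all_vertices.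
Proof. by apply/mem_created => -[[i' j'] _ [//|[]]]. Qed.

Lemma ext_bottom_created j : (ext_bottom j : E) \notin created all_vertices.
Proof.
apply/mem_created => -[[i' j'] _ [[e _]|//]].
by move: e; rewrite /=; have := ltn_ord i'; lia.
Qed.

Definition left_bottom (c : config) :=
  [forall i : 'I_n, c (ext_left i) == i :> nat] && [forall j : 'I_n, c (ext_bottom j) == n :> nat].
Definition top_right_ext (c : config) :=
  [forall j : 'I_n, c (ext_top j) == j :> nat] && [forall i : 'I_n, c (ext_right i) == n :> nat].
Definition ice_rule (c : config) (i j : 'I_n) :=
  (c (edge_left i j) == c (edge_top i j)) && (c (edge_bottom i j) == c (edge_right i j)) ||
  (c (edge_left i j) == c (edge_right i j)) && (c (edge_bottom i j) == c (edge_top i j)).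
Definition valid (c : config) :=
  [&& left_bottom c, top_right_ext c & [forall i, forall j, ice_rule c i j]].

Lemma word_initial c : left_bottom c -> word_of c (row_frontier n) = idw n.
Proof.
case/andP=> /forallP hl /forallP hb; apply/funext => p; rewrite /word_of /row_frontier /idw.
case: ltnP => h1.
  rewrite (@hedgeE (Ordinal h1) ord0) // -[inl _]/(ext_left (Ordinal h1)).
  by rewrite (eqP (hl _)) /=; lia.
case: ltnP => h2; last by rewrite hedge_out ?leq_subRL //; lia.
have h3 : (p - n < n)%N by lia.
by rewrite (@vedgeE ord_max (Ordinal h3)) // -[inr _]/(ext_bottom (Ordinal h3)) (eqP (hb _)); lia.
Qed.

Lemma word_final c : reflect (word_of c (row_frontier 0) = idw n) (top_right_ext c).
Proof.
apply: (iffP andP) => [[/forallP ht /forallP hr]|h].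
  apply/funext => p; rewrite /word_of /row_frontier /idw ltn0 add0n subn0.
  case: ltnP => h1.
    rewrite (@vedgeE ord0 (Ordinal h1)) // -[inr _]/(ext_top (Ordinal h1)).
    by rewrite (eqP (ht _)) /=; lia.
  have [h2|h2] := ltnP (p - n) n; last by rewrite hedge_out //; lia.
  by rewrite (@hedgeE (Ordinal h2) ord_max) // -[inl _]/(ext_right (Ordinal h2)) (eqP (hr _)); lia.
split; apply/forallP => i; apply/eqP.
  have := congr1 (fun w => w (i : nat)) h; rewrite /= /word_of /row_frontier /idw ltn0 add0n subn0.
  rewrite ltn_ord (@vedgeE ord0 i) // -[inr _]/(ext_top i) => ->.
  by have := ltn_ord i; lia.
have := congr1 (fun w => w (i + n)%N) h; rewrite /= /word_of /row_frontier /idw ltn0 add0n.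
by rewrite ltnNge leq_addl addnK /= (@hedgeE i ord_max) // -[inl _]/(ext_right i) => ->; lia.
Qed.

(** The initial word imposes the labels on the left and bottom boundary and [delta] tests those on
    the top and right boundary. Configurations that break [ice_rule] at some vertex are included in
    the free sum but have weight 0. *)
Lemma config_sum (y : vertex -> R) :
  \sum_(c | valid c) \prod_(v : vertex) cice t y c v =
  run [seq Rl t (diag v) (y v) | v <- all_vertices] (delta R (idw n)) (idw n).
Proof.
pose c0 : config := [ffun e => if e is inl (i, _) then widen_ord (leqnSn n) i else ord_max].
have lb0 : left_bottom c0.
  by apply/andP; split; apply/forallP => i; rewrite ffunE.
have [s1 s2] := all_sched.
rewrite -(word_initial lb0) -(@sched_sum _ t n y all_vertices (row_frontier n) c0 _ s1); first last.
- move=> p e; rewrite /row_frontier; case: ltnP => h1.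
    by rewrite (@hedgeE (Ordinal h1) ord0) // => -[<-]; apply: ext_left_created.
  case: ltnP => h2; last by rewrite hedge_out //; lia.
  have h3 : (p - n < n)%N by lia.
  by rewrite (@vedgeE ord_max (Ordinal h3)) // => -[<-]; apply: ext_bottom_created.
- exact: uniq_created uniq_all_vertices.
rewrite s2 big_mkcond [RHS]big_mkcond; apply: eq_bigr => c _.
have pE : \prod_(v <- all_vertices) cice t y c v = \prod_(v : vertex) cice t y c v.
  apply: perm_big; apply: uniq_perm; rewrite ?uniq_all_vertices ?index_enum_uniq //.
  by move=> v; rewrite mem_all_vertices mem_index_enum.
have lbE : [forall e, (e \in created all_vertices) || (c e == c0 e)] = left_bottom c.
  apply/forallP/andP => [h|[/forallP hl /forallP hb] e].
    split; apply/forallP => i.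
      by have := h (ext_left i); rewrite (negPf (ext_left_created i)) ffunE /= => /eqP ->.
    by have := h (ext_bottom i); rewrite (negPf (ext_bottom_created i)) ffunE /= => /eqP ->.
  case: (edge_cases e) => [[i ->]|[j ->]|->] //; apply/orP; right; rewrite ffunE -val_eqE /=.
    exact: hl.
  exact: hb.
rewrite lbE pE /valid; case: left_bottom => //=.
have [/word_final tr /=|ntr] := boolP (top_right_ext c); last first.
  rewrite delta_ne ?mulr0 // (word_initial lb0) => /word_final.
  exact/negP.
rewrite (word_initial lb0) tr delta_id mulr1; case: ifP => // /negbT.
rewrite negb_forall => /existsP[i]; rewrite negb_forall => /existsP[j hij].
rewrite (bigD1 (i, j)) //= {1}/cice ice_ne ?mul0r //= => H; case/negP: hij; rewrite /ice_rule.
by case: H => -[/val_inj -> /val_inj ->]; rewrite !eqxx ?orbT.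
Qed.

Lemma row_iota k y xs : grid_row t k y xs = [seq Rl t (k + j) (y / xs`_j) | j <- iota 0 (size xs)].
Proof.
elim: xs k => //= x xs IH k; rewrite addn0 IH (iotaDl 1 0) -map_comp; congr (_ :: _).
by apply: eq_map => j /=; rewrite addSnnS.
Qed.

Lemma grid_iota k ys xs :
  grid t k ys xs = flatten [seq grid_row t (k + i) ys`_i xs | i <- rev (iota 0 (size ys))].
Proof.
elim: ys k => //= y ys IH k; rewrite IH rev_cons map_rcons -cats1 flatten_cat /= addn0 cats0.
congr (flatten _ ++ _); rewrite (iotaDl 1 0) -map_rev -map_comp.
by apply: eq_map => j /=; rewrite addSnnS.
Qed.

Lemma grid_vertices (Y X : 'I_n -> R) :
  grid t 0 [seq Y i | i <- enum 'I_n] [seq X i | i <- enum 'I_n] =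
  [seq Rl t (diag v) (Y v.1 / X v.2) | v <- all_vertices].
Proof.
have nthE (F : 'I_n -> R) (k : 'I_n) : [seq F i | i <- enum 'I_n]`_k = F k.
  by rewrite (nth_map k) ?size_enum_ord // nth_ord_enum.
have sX : size [seq X i | i <- enum 'I_n] = n by rewrite size_map size_enum_ord.
rewrite grid_iota size_map size_enum_ord.
move: [seq X i | i <- enum 'I_n] [seq Y i | i <- enum 'I_n] sX (nthE X) (nthE Y) => xs ys sX nX nY.
rewrite -val_enum_ord -map_rev -map_comp /all_vertices map_flatten -map_comp.
congr flatten; apply: eq_map => i /=.
rewrite row_iota sX -val_enum_ord -!map_comp; apply: eq_map => j /=.
by rewrite nX nY.
Qed.

End Schedule.

(** * Families of paths and edge labellings *)

Section Bijection.
Variable n : nat.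

Local Notation E := (edge n).
Local Notation config := {ffun edge n -> 'I_n.+1}.
Local Notation vertex := ('I_n * 'I_n)%type.

(** [None] occurs exactly on the right and top external edges, where no vertex follows. *)
Definition entry (e : E) : option vertex :=
  match e with
  | inl (i, k) => omap (fun j : 'I_n => (i, j)) (insub (k : nat))
  | inr (k, j) => omap (fun i : 'I_n => (i, j)) (unlift ord0 k)
  end.

(* Every step of a path raises the height by one. *)
Definition height (e : E) : nat :=
  match e with
  | inl (i, k) => n - i.+1 + k
  | inr (k, j) => n - k + j
  end.

Lemma entry_left (i j : 'I_n) : entry (edge_left i j) = Some (i, j).
Proof. by rewrite /= valK. Qed.
Lemma entry_bottom (i j : 'I_n) : entry (edge_bottom i j) = Some (i, j).
Proof. by rewrite /= liftK. Qed.

Lemma entryP e (i j : 'I_n) :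
  entry e = Some (i, j) <-> e = edge_left i j \/ e = edge_bottom i j.
Proof.
split=> [|[]->]; rewrite ?entry_left ?entry_bottom //.
case: e => -[a b] /=.
  case: insubP => //= k _ hk [-> <-]; left; congr (inl (_, _)).
  by apply: val_inj; rewrite /= hk.
by case: unliftP => //= k -> [-> ->]; right.
Qed.

Lemma height_left (i j : 'I_n) : height (edge_left i j) = (n - i.+1 + j)%N.
Proof. by []. Qed.
Lemma height_bottom (i j : 'I_n) : height (edge_bottom i j) = (n - i.+1 + j)%N.
Proof. by []. Qed.
Lemma height_right (i j : 'I_n) : height (edge_right i j) = (n - i.+1 + j).+1.
Proof. by rewrite /= /bump /=; lia. Qed.
Lemma height_top (i j : 'I_n) : height (edge_top i j) = (n - i.+1 + j).+1.
Proof. by rewrite /=; have := ltn_ord i; lia. Qed.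
Lemma height_max e : (height e <= n.*2)%N.
Proof. by case: e => -[a b] /=; have := ltn_ord a; have := ltn_ord b; lia. Qed.

Lemma path_stepP e e' :
  reflect (exists i j : 'I_n, entry e = Some (i, j) /\ (e' = edge_right i j \/ e' = edge_top i j))
    (path_step e e').
Proof.
apply: (iffP existsP) => [[i /existsP[j /andP[]]]|[i [j [/entryP he he']]]].
  rewrite !inE => he he'; exists i, j; split; first by apply/entryP; case/orP: he => /eqP; auto.
  by case/orP: he' => /eqP; auto.
exists i; apply/existsP; exists j; rewrite !inE.
by case: he => ->; case: he' => ->; rewrite !eqxx ?orbT.
Qed.

Lemma height_step e e' : path_step e e' -> height e' = (height e).+1.
Proof.
case/path_stepP => i [j [/entryP he he']].
have -> : height e = (n - i.+1 + j)%N by case: he => ->.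
by case: he' => ->; rewrite ?height_right ?height_top.
Qed.

Lemma entry_height e (i j : 'I_n) : entry e = Some (i, j) -> height e = (n - i.+1 + j)%N.
Proof. by case/entryP => ->. Qed.

Lemma entry_None e : entry e = None ->
  (exists i, e = ext_right i) \/ (exists j, e = ext_top j).
Proof.
case: e => -[a b] /=.
  case: insubP => //= hb _; left; exists a; congr (inl (_, _)); apply: val_inj => /=.
  by have := ltn_ord b; lia.
by case: unliftP => //= -> _; right; exists b.
Qed.

Definition next_edge (c : config) (a : nat) (e : E) : E :=
  if entry e is Some v then
    if c (edge_right v.1 v.2) == a :> nat then edge_right v.1 v.2 else edge_top v.1 v.2
  else e.
(** The height is [n - a.+1] at [ext_left a] and [n + a] at [ext_top a]; with identity connectivity
    the path a therefore has exactly [a.+1.*2] edges. *)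
Definition path_of (c : config) (a : 'I_n) : seq E :=
  traject (next_edge c a) (ext_left a) a.+1.*2.
Definition paths_of (c : config) : path_family n := [ffun a => insub_bseq n.*2 (path_of c a)].
Definition config_of (P : path_family n) : config := [ffun e => inord (label P e)].

Lemma size_path_of c a : size (path_of c a) = a.+1.*2.
Proof. exact: size_traject. Qed.
Lemma paths_ofE c a : paths_of c a = path_of c a :> seq E.
Proof.
have h : (size (path_of c a) <= n.*2)%N by rewrite size_path_of; have := ltn_ord a; lia.
by rewrite ffunE /insub_bseq insubdK.
Qed.

Section OfConfig.
Variable c : config.
Hypothesis cv : valid c.

Let c_left i : c (ext_left i) = i :> nat.
Proof. by case/and3P: cv => /andP[/forallP h _] _ _; apply/eqP/h. Qed.
Let c_bottom i : c (ext_bottom i) = n :> nat.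
Proof. by case/and3P: cv => /andP[_ /forallP h] _ _; apply/eqP/h. Qed.
Let c_top i : c (ext_top i) = i :> nat.
Proof. by case/and3P: cv => _ /andP[/forallP h _] _; apply/eqP/h. Qed.
Let c_right i : c (ext_right i) = n :> nat.
Proof. by case/and3P: cv => _ /andP[_ /forallP h] _; apply/eqP/h. Qed.
Let c_ice i j : ice_rule c i j.
Proof. by case/and3P: cv => _ _ /forallP h; have /forallP := h i. Qed.

Variable a : 'I_n.
Let s m := iter m (next_edge c a) (ext_left a).

Lemma next_edge_label e (i j : 'I_n) : entry e = Some (i, j) -> c e = a :> nat ->
  c (next_edge c a e) = a :> nat.
Proof.
move=> he ce; rewrite /next_edge he /=; case: eqP => // hr.
have := c_ice i j; rewrite /ice_rule.
by case/entryP: he ce => -> ce /orP[]/andP[/eqP h1 /eqP h2]; move: ce hr; rewrite ?h1 ?h2.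
Qed.

Lemma next_edge_step e (i j : 'I_n) : entry e = Some (i, j) -> path_step e (next_edge c a e).
Proof.
move=> he; apply/path_stepP; exists i, j; split=> //.
by rewrite /next_edge he; case: ifP; auto.
Qed.

Lemma iter_next m : (forall m', (m' < m)%N -> s m' != ext_top a) ->
  c (s m) = a :> nat /\ height (s m) = (n - a.+1 + m)%N.
Proof.
elim: m => [|m IH] h; first by rewrite /= c_left.
have [IH1 IH2] := IH (fun m' hm' => h m' (ltnW hm')).
rewrite /s iterS -/(s m).
case he : (entry (s m)) => [[i j]|]; last first.
  case: (entry_None he) => -[k hk].
    by move: IH1; rewrite hk c_right; have := ltn_ord a; lia.
  have := h m (ltnSn m); rewrite hk; case/negP; apply/eqP; congr ext_top.
  by apply: val_inj; rewrite /= -IH1 hk c_top.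
rewrite (next_edge_label he IH1); split=> //.
by rewrite (height_step (next_edge_step he)) IH2 addnS.
Qed.

(** Until it meets [ext_top a], the trajectory keeps its label and gains height. Heights are
    bounded, so it does meet that edge, and the height there gives the time of the first visit. *)
Lemma exit_top : s a.*2.+1 = ext_top a /\ forall m, (m < a.*2.+1)%N -> s m != ext_top a.
Proof.
have ex : exists m, s m == ext_top a.
  apply: contrapT => nex.
  have h m : s m != ext_top a by apply/negP => hm; apply: nex; exists m.
  have [_ hh] := @iter_next n.*2.+1 (fun m' _ => h m').
  by have := height_max (s n.*2.+1); rewrite hh; lia.
case: (ex_minnP ex) => M /eqP hM minM.
have hlt m : (m < M)%N -> s m != ext_top a.
  by move=> hm; apply/negP => /minM; lia.
have [_ hh] := iter_next hlt.
have e : M = a.*2.+1.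
  move: hh; rewrite hM /= subn0; have := ltn_ord a; lia.
by rewrite -e; split.
Qed.

Lemma iter_label m : (m < a.+1.*2)%N -> c (s m) = a :> nat /\ height (s m) = (n - a.+1 + m)%N.
Proof.
move=> hm; apply: iter_next => m' hm'; have [_] := exit_top; apply.
by move: hm hm'; rewrite doubleS; lia.
Qed.

(** Induction on the height: by the ice rule the label a on an edge is inherited from an edge
    entering the same vertex, which is on the trajectory, and the trajectory then has to choose
    e. *)
Lemma label_iter e : c e = a :> nat -> exists2 m, (m < a.+1.*2)%N & e = s m.
Proof.
have := leqnn (height e); move: {2}(height e) => h.
elim: h e => [|h IH] e he ce.
all: case: (edge_cases e) => [[i ei]|[j ej]|/mem_created[[i j] _ /= ev]].
- by exists 0%N; rewrite ?doubleS // ei; congr ext_left; apply: val_inj; rewrite /= -ce ei c_left.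
- by move: ce; rewrite ej c_bottom; have := ltn_ord a; lia.
- by case: ev he => ->; rewrite ?height_top ?height_right.
- by exists 0%N; rewrite ?doubleS // ei; congr ext_left; apply: val_inj; rewrite /= -ce ei c_left.
- by move: ce; rewrite ej c_bottom; have := ltn_ord a; lia.
have IHl e0 : entry e0 = Some (i, j) -> c e0 = a :> nat ->
    exists2 m, (m < a.*2.+1)%N & e0 = s m.
  move=> h0 c0; have [|m hm em] := IH e0 _ c0.
    rewrite (entry_height h0); case: ev he => ->; rewrite ?height_top ?height_right; lia.
  exists m => //; rewrite ltn_neqAle; apply/andP; split; last by move: hm; rewrite doubleS; lia.
  apply/eqP => em'; have [ex _] := exit_top; move: h0.
  by rewrite em em' ex /= unlift_none.
have /entryP hlft : edge_left i j = edge_left i j \/ edge_left i j = edge_bottom i j by left.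
have /entryP hbot : edge_bottom i j = edge_left i j \/ edge_bottom i j = edge_bottom i j by right.
have step e0 : entry e0 = Some (i, j) -> c e0 = a :> nat -> next_edge c a e0 = e ->
    exists2 m, (m < a.+1.*2)%N & e = s m.
  move=> h0 c0 ne; have [m hm em] := IHl e0 h0 c0.
  by exists m.+1; [rewrite doubleS; lia | rewrite /s iterS -/(s m) -em ne].
have ne e0 : entry e0 = Some (i, j) -> next_edge c a e0 = e.
  move=> h0; rewrite /next_edge h0 /=; case: ev => ee; last first.
    by rewrite -ee ce eqxx.
  (* The trajectory prefers the right edge, so the top edge would be missed if both carried a. Then
     both incoming edges would carry a as well; having equal heights on one trajectory, they would
     coincide. *)
  case: eqP => // hr; exfalso.
  have [cl cb] : c (edge_left i j) = a :> nat /\ c (edge_bottom i j) = a :> nat.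
    have := c_ice i j; rewrite /ice_rule -ee.
    by case/orP=> /andP[/eqP -> /eqP ->]; rewrite ?ce ?hr.
  have [m1 hm1 e1] := IHl _ hlft cl; have [m2 hm2 e2] := IHl _ hbot cb.
  have [_ H1] := @iter_label m1 ltac:(rewrite doubleS; lia).
  have [_ H2] := @iter_label m2 ltac:(rewrite doubleS; lia).
  have em : m1 = m2.
    by move: H1 H2; rewrite -e1 -e2 height_left height_bottom; lia.
  by move: e1; rewrite em -e2.
have := c_ice i j; rewrite /ice_rule.
case: ev => ee; rewrite -ee => /orP[]/andP[/eqP h1 /eqP h2].
- by apply: (step _ hlft) => //; [rewrite h1|exact: ne].
- by apply: (step _ hbot) => //; [rewrite h2|exact: ne].
- by apply: (step _ hbot) => //; [rewrite h2|exact: ne].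
- by apply: (step _ hlft) => //; [rewrite h1|exact: ne].
Qed.

Lemma mem_path_of e : (e \in path_of c a) = (c e == a :> nat).
Proof.
apply/trajectP/eqP => [[m hm ->]|/label_iter[m hm ->]]; last by exists m.
by have [] := iter_label hm.
Qed.

Lemma sorted_path_of : sorted (@path_step n) (path_of c a).
Proof.
apply/(sortedP (ext_left a)) => m; rewrite size_path_of => hm.
rewrite !nth_traject //; last exact: ltnW.
rewrite iterS -!/(s _).
case he : (entry (s m)) => [[i j]|]; first exact: next_edge_step he.
have [lm _] := iter_label (ltnW hm).
case: (entry_None he) => -[k hk].
  by move: lm; rewrite hk c_right; have := ltn_ord a; lia.
have [_ /(_ m)] := exit_top; rewrite hk; case/(_ _)/negP; first by move: hm; rewrite doubleS; lia.
by apply/eqP; congr ext_top; apply: val_inj; rewrite /= -lm hk c_top.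
Qed.

Lemma exits_path_of : path_exits_at (path_of c a) a.
Proof.
have [ex _] := exit_top.
by rewrite /path_exits_at /path_of doubleS trajectSr rev_rcons -[iter _ _ _]/(s a.*2.+1) ex /= eqxx.
Qed.

End OfConfig.

Lemma lattice_paths_of c : valid c -> lattice_paths (paths_of c) && conn (paths_of c) 1.
Proof.
move=> cv; rewrite /lattice_paths /conn.
have ex a : path_exits_at (paths_of c a) a by rewrite paths_ofE; exact: exits_path_of.
apply/andP; split; last by apply/forallP => a; rewrite invg1 perm1.
have [_ tr _] := and3P cv; case/andP: (tr) => _ /forallP cr.
have [/andP[_ /forallP cb] _ _] := and3P cv.
apply/and4P; split.
- apply/forallP => a; rewrite paths_ofE sorted_path_of // andbT.
  by rewrite /path_of doubleS.
- by apply/forallP => a; apply/existsP; exists a.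
- apply/forallP => a; apply/forallP => j; rewrite paths_ofE !mem_path_of //.
  by rewrite (eqP (cr j)) (eqP (cb j)); have := ltn_ord a; case: eqP => //; lia.
- apply/forallP => a; apply/forallP => b; apply/implyP => nab.
  apply/hasPn => e; rewrite paths_ofE mem_path_of // => /eqP eb.
  rewrite -[mem _ _]/(e \in (paths_of c a : seq E)) paths_ofE mem_path_of // eb.
  by rewrite val_eqE eq_sym.
Qed.

Lemma label_le (P : path_family n) e : (label P e <= n)%N.
Proof. by rewrite /label; case: pickP => // a _; exact: (ltnW (ltn_ord a)). Qed.

Lemma config_ofE (P : path_family n) e : config_of P e = label P e :> nat.
Proof. by rewrite ffunE inordK // ltnS label_le. Qed.

Lemma config_ofK c : valid c -> config_of (paths_of c) = c.
Proof.
move=> cv; apply/ffunP => e; apply: ord_inj; rewrite config_ofE /label /=.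
case: pickP => [a|h]; first by rewrite paths_ofE mem_path_of // => /eqP.
apply/eqP; have := ltn_ord (c e); rewrite ltnS leq_eqVlt => /orP[/eqP ->|hn]; first by [].
by have := h (Ordinal hn); rewrite paths_ofE mem_path_of // eqxx.
Qed.

Section OfPaths.
Variable P : path_family n.
Hypothesis Plat : lattice_paths P.
Hypothesis Pconn : conn P 1.

Let P_head a : exists s, P a = ext_left a :: s :> seq E.
Proof.
case/and4P: Plat => /forallP/(_ a)/andP[h _] _ _ _.
by case: (P a : seq E) h => // e s /eqP[->]; exists s.
Qed.
Let P_sorted a : sorted (@path_step n) (P a).
Proof. by case/and4P: Plat => /forallP/(_ a)/andP[_ h]. Qed.
Let P_last a : exists s, P a = rcons s (ext_top a) :> seq E.
Proof.
move/forallP/(_ a): Pconn; rewrite invg1 perm1 /path_exits_at.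
by case/lastP: (P a : seq E) => // s e; rewrite rev_rcons => /eqP[->]; exists s.
Qed.
Let P_disj a b e : e \in (P a : seq E) -> e \in (P b : seq E) -> a = b.
Proof.
move=> ha hb; apply/eqP; apply: contraT => nab.
case/and4P: Plat => _ _ _ /forallP/(_ a)/forallP/(_ b)/implyP/(_ nab)/hasPn/(_ e hb).
by rewrite inE ha.
Qed.
Let P_right a j : ext_right j \notin (P a : seq E).
Proof. by case/and4P: Plat => _ _ /forallP/(_ a)/forallP/(_ j)/andP[]. Qed.
Let P_bottom a j : ext_bottom j \notin (P a : seq E).
Proof. by case/and4P: Plat => _ _ /forallP/(_ a)/forallP/(_ j)/andP[]. Qed.

Lemma mem_label a e : e \in (P a : seq E) -> label P e = a.
Proof.
move=> ha; rewrite /label; case: pickP => [b hb|/(_ a)]; last by rewrite ha.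
by rewrite (P_disj hb ha).
Qed.

Lemma label_mem (a : 'I_n) e : label P e = a -> e \in (P a : seq E).
Proof.
rewrite /label; case: pickP => [b hb /val_inj <- //|_ h].
by have := ltn_ord a; lia.
Qed.

Lemma height_nth a m : (m < size (P a))%N ->
  height (nth (ext_left a) (P a) m) = (n - a.+1 + m)%N.
Proof.
elim: m => [|m IH] hm; first by have [s ->] := P_head a.
have /(sortedP (ext_left a))/(_ m hm)/height_step -> := P_sorted a.
by rewrite IH ?addnS //; exact: ltnW.
Qed.

Lemma size_path a : size (P a) = a.+1.*2.
Proof.
have [s hs] := P_last a.
have hm : (size s < size (P a))%N by rewrite hs size_rcons.
have := height_nth hm; rewrite {1}hs nth_rcons ltnn eqxx /= subn0.
by rewrite hs size_rcons; have := ltn_ord a; lia.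
Qed.

Lemma height_inj a e e' : e \in (P a : seq E) -> e' \in (P a : seq E) ->
  height e = height e' -> e = e'.
Proof.
move=> he he'; rewrite -(nth_index (ext_left a) he) -(nth_index (ext_left a) he').
rewrite !height_nth ?index_mem // => h.
by congr nth; lia.
Qed.

Lemma path_succ a e (i j : 'I_n) : e \in (P a : seq E) -> entry e = Some (i, j) ->
  edge_right i j \in (P a : seq E) \/ edge_top i j \in (P a : seq E).
Proof.
move=> he hv; have hi : (index e (P a) < size (P a))%N by rewrite index_mem.
have [hi'|hi'] := ltnP (index e (P a)).+1 (size (P a)); last first.
  have [s hs] := P_last a.
  have ee : e = ext_top a.
    rewrite -(nth_index (ext_left a) he) hs nth_rcons.
    have -> : index e (rcons s (ext_top a)) = size s.
      by move: hi hi'; rewrite hs size_rcons; lia.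
    by rewrite ltnn eqxx.
  by move: hv; rewrite ee /= unlift_none.
have /(sortedP (ext_left a))/(_ _ hi')/path_stepP := P_sorted a.
rewrite nth_index // hv => -[i' [j' [[<- <-] h]]].
by case: h => <-; [left|right]; apply: mem_nth.
Qed.

Lemma path_pred a e (i j : 'I_n) : e \in (P a : seq E) -> e = edge_right i j \/ e = edge_top i j ->
  edge_left i j \in (P a : seq E) \/ edge_bottom i j \in (P a : seq E).
Proof.
move=> he hv; have hi : (index e (P a) < size (P a))%N by rewrite index_mem.
case hx : (index e (P a)) => [|m].
  have [s hs] := P_head a.
  have ee : e = ext_left a by rewrite -(nth_index (ext_left a) he) hx hs.
  by case: hv; rewrite ee // => -[].
have hm : (m.+1 < size (P a))%N by rewrite -hx.
have /(sortedP (ext_left a))/(_ _ hm)/path_stepP := P_sorted a.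
rewrite -hx nth_index // => -[i' [j' [/entryP h1 h2]]].
have [ei ej] : i = i' /\ j = j'.
  case: hv => ->  in h2 *.
    by case: h2 => // -[ei ej]; split=> //; apply: val_inj; move: ej; rewrite /= /bump /=; lia.
  by case: h2 => // -[ei ej]; split=> //; apply: val_inj.
rewrite -{}ei -{}ej in h1.
by case: h1 => <-; [left|right]; apply: mem_nth; apply: ltnW.
Qed.

Lemma valid_config_of : valid (config_of P).
Proof.
apply/and3P; split.
- apply/andP; split; apply/forallP => i; rewrite config_ofE.
    by apply/eqP/mem_label; have [s ->] := P_head i; rewrite inE eqxx.
  rewrite /label; case: pickP => // a ha.
  by have := P_bottom a i; rewrite ha.
- apply/andP; split; apply/forallP => i; rewrite config_ofE.
    by apply/eqP/mem_label; have [s ->] := P_last i; rewrite mem_rcons inE eqxx.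
  rewrite /label; case: pickP => // a ha.
  by have := P_right a i; rewrite ha.
apply/forallP => i; apply/forallP => j; rewrite /ice_rule -!val_eqE /= !config_ofE.
(* A path that enters the vertex leaves it and conversely ([F1], [F2]), and it uses one incoming and
   one outgoing edge at most, since edges of a path have distinct heights ([F3], [F4]). The ice rule
   is then arithmetic on four numbers, the value n of empty edges being exempt from these
   constraints. *)
have F1 (a : 'I_n) : label P (edge_left i j) = a \/ label P (edge_bottom i j) = a ->
   label P (edge_right i j) = a \/ label P (edge_top i j) = a.
  have hl := entry_left i j; have hb := entry_bottom i j.
  by case=> /label_mem h; [have := path_succ h hl|have := path_succ h hb];
    case=> /mem_label; auto.
have F2 (a : 'I_n) : label P (edge_right i j) = a \/ label P (edge_top i j) = a ->
   label P (edge_left i j) = a \/ label P (edge_bottom i j) = a.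
  by case=> /label_mem h; (have := @path_pred a _ i j h); case; auto; move=> /mem_label; auto.
have F3 (a : 'I_n) : ~ (label P (edge_left i j) = a /\ label P (edge_bottom i j) = a).
  by case=> /label_mem h1 /label_mem h2; have := height_inj h1 h2 (erefl _).
have F4 (a : 'I_n) : ~ (label P (edge_right i j) = a /\ label P (edge_top i j) = a).
  case=> /label_mem h1 /label_mem h2; have := height_inj h1 h2.
  by rewrite height_right height_top => /(_ (erefl _)).
have lt x : (x < n)%N -> exists a : 'I_n, x = a by move=> h; exists (Ordinal h).
have := label_le P (edge_left i j); have := label_le P (edge_right i j).
have := label_le P (edge_top i j); have := label_le P (edge_bottom i j).
move: (label P (edge_left i j)) (label P (edge_right i j)) (label P (edge_top i j))
  (label P (edge_bottom i j)) F1 F2 F3 F4 => l r u d F1 F2 F3 F4 hd hu hr hl.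
have G1 x : (x < n)%N -> l = x \/ d = x -> r = x \/ u = x by case/lt => a ->; apply: F1.
have G2 x : (x < n)%N -> r = x \/ u = x -> l = x \/ d = x by case/lt => a ->; apply: F2.
have G3 x : (x < n)%N -> ~ (l = x /\ d = x) by case/lt => a ->; apply: F3.
have G4 x : (x < n)%N -> ~ (r = x /\ u = x) by case/lt => a ->; apply: F4.
have A1 h := G1 l h (or_introl erefl); have A2 h := G1 d h (or_intror erefl).
have A3 h := G2 r h (or_introl erefl); have A4 h := G2 u h (or_intror erefl).
have A5 := G3 l; have A6 := G4 u; clear F1 F2 F3 F4 G1 G2 G3 G4.
case: (ltnP l n) A1 A5 => hl' A1 A5; case: (ltnP d n) A2 => hd' A2;
case: (ltnP r n) A3 => hr' A3; case: (ltnP u n) A4 A6 => hu' A4 A6; lia.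
Qed.

Lemma paths_ofK : paths_of (config_of P) = P.
Proof.
apply/ffunP => a; apply: val_inj; rewrite /= -[LHS]/(paths_of (config_of P) a : seq E) paths_ofE.
apply: (@eq_from_nth _ (ext_left a)); first by rewrite size_path_of size_path.
move=> m; rewrite size_path_of => hm; rewrite nth_traject //.
elim: m hm => [|m IH] hm; first by have [s ->] := P_head a.
rewrite iterS IH; last exact: ltnW.
have hm' : (m.+1 < size (P a))%N by rewrite size_path.
have /(sortedP (ext_left a))/(_ _ hm')/path_stepP[i [j [h1 h2]]] := P_sorted a.
rewrite /next_edge h1 /= config_ofE.
have mem := mem_nth (ext_left a) hm'.
case: h2 => h2; rewrite h2 in mem *; first by rewrite (mem_label mem) eqxx.
case: eqP => // /label_mem mem'.
by have := height_inj mem' mem; rewrite height_right height_top => /(_ (erefl _)).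
Qed.

End OfPaths.

(** This is the shape of the condition produced by [reindex_onto] when a sum over labellings is
    rewritten over path families. *)
Lemma lattice_pathsP P :
  lattice_paths P && conn P 1 = valid (config_of P) && (paths_of (config_of P) == P).
Proof.
apply/idP/idP => [/andP[h1 h2]|/andP[h1 /eqP h2]].
  by rewrite valid_config_of // paths_ofK // eqxx.
by rewrite -h2; apply: lattice_paths_of.
Qed.

End Bijection.

(** * Recurrence and symmetry of the partition function *)

Section PartitionFunction.
Variables (R : fieldType) (q t : R).

Local Notation Z xs := (Theta t (size xs) [seq q^-1 * x | x <- xs] xs).

Lemma vertex_weight_cice n (x : 'I_n -> R) (P : path_family n) (i j : 'I_n) :
  ice_rule (config_of P) i j ->
  vertex_weight q t x P i j =
  cice t (fun v => q^-1 * x v.1 / x v.2) (config_of P) (i, j).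
Proof.
rewrite /ice_rule -!val_eqE /= !config_ofE /vertex_weight /cice /ice /= !config_ofE.
move: (label P (edge_left i j)) (label P (edge_top i j)) (label P (edge_right i j))
  (label P (edge_bottom i j)) => l u r d.
case/orP=> /andP[/eqP <- /eqP <-]; rewrite !eqxx /=.
  by case: (ltngtP l d) => // <-; rewrite eqxx.
by rewrite [d == l]eq_sym; case: (ltngtP l d).
Qed.

Lemma partition_functionE n (x : 'I_n -> R) :
  partition_function q t x 1 = alpha n q t *
    Theta t n [seq q^-1 * z | z <- [seq x i | i <- enum 'I_n]] [seq x i | i <- enum 'I_n].
Proof.
rewrite /partition_function; congr (_ * _).
rewrite /Theta -map_comp (grid_vertices t (fun i => q^-1 * x i) x).
rewrite -(config_sum t (fun v => q^-1 * x v.1 / x v.2)).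
rewrite (reindex_onto (@config_of n) (@paths_of n)) => [|c]; last exact: config_ofK.
apply: eq_big => [P|P]; first exact: lattice_pathsP.
rewrite lattice_pathsP => /andP[/and3P[_ _ /forallP h] _].
rewrite /wt (pair_bigA _ (fun i j => vertex_weight q t x P i j)) /=.
by apply: eq_bigr => -[i j] _ /=; apply: vertex_weight_cice; have /forallP := h i.
Qed.

Lemma partition_function0 (x : 'I_0 -> R) : partition_function q t x 1 = 1.
Proof.
have e : enum 'I_0 = [::] by apply: size0nil; rewrite size_enum_ord.
by rewrite partition_functionE e /Theta /= delta_id mulr1 /alpha /= !expr0 invr1 mulr1.
Qed.

Lemma alphaS n : t != 0 -> alpha n.+1 q t = (q / t) ^+ n / (1 - t) * alpha n q t.
Proof.
move=> t0; rewrite /alpha.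
have -> : (n.+1 * n.+1.-1)./2 = (n + (n * n.-1)./2)%N.
  case: n => [|n] //; rewrite !succnK.
  have -> : (n.+2 * n.+1 = n.+1.*2 + n.+1 * n)%N by rewrite -muln2; ring.
  by rewrite halfD odd_double doubleK.
by rewrite exprD exprS invfM; ring.
Qed.

Lemma others_lift n (x : 'I_n.+1 -> R) (i : 'I_n.+1) :
  let xs := [seq x j | j <- enum 'I_n.+1] in
  take i xs ++ drop i.+1 xs = [seq x (lift i j) | j <- enum 'I_n].
Proof.
move=> xs; have sxs : size xs = n.+1 by rewrite size_map size_enum_ord.
have nthx (k : 'I_n.+1) : xs`_k = x k.
  by rewrite (nth_map k) ?size_enum_ord // nth_ord_enum.
have hi := ltn_ord i.
apply: (@eq_from_nth _ 0) => [|k].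
  by rewrite size_cat size_take size_drop sxs hi size_map size_enum_ord; lia.
rewrite size_cat size_take size_drop sxs hi => hk.
have hk' : (k < n)%N by lia.
rewrite (nth_map (Ordinal hk')) ?size_enum_ord // -[k in RHS]/(nat_of_ord (Ordinal hk')) nth_ord_enum.
rewrite -nthx /= /bump nth_cat size_take sxs hi.
case: ltnP => hki; first by rewrite nth_take.
by rewrite nth_drop add1n; congr nth; lia.
Qed.

Lemma big_lift n (i : 'I_n.+1) (F : 'I_n.+1 -> R) :
  \prod_(j < n.+1 | j != i) F j = \prod_(j < n) F (lift i j).
Proof.
rewrite big_mkcond (bigD1_ord i) //= eqxx mul1r.
by apply: eq_bigr => j _; rewrite eq_sym neq_lift.
Qed.

Theorem partition_function_recurrence n (x : 'I_n.+1 -> R) :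
  q != 0 -> t != 0 -> 1 - t != 0 -> injective x -> (forall i, x i != 0) ->
  (\sum_(i < n.+1) x i) * partition_function q t x 1 =
  \sum_(i < n.+1) x i * partition_function q t (fun j => x (lift i j)) 1 *
    \prod_(j < n.+1 | j != i)
      ((1 - q^-1 * (x j / x i)) * (1 - q * t^-1 * (x j / x i)) * (1 - t * (x j / x i))
       / (- (x j / x i) * (1 - x j / x i))).
Proof.
move=> q0 t0 t1 xinj x0; rewrite !partition_functionE alphaS //.
set xs := [seq x i | i <- enum 'I_n.+1].
have sxs : size xs = n.+1 by rewrite size_map size_enum_ord.
have uxs : uniq xs by rewrite map_inj_uniq ?enum_uniq.
have xs0 : 0 \notin xs by apply/mapP => -[i _ /esym/eqP]; exact/negP.
have q0' : q^-1 != 0 by rewrite invr_eq0.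
have nthx (k : 'I_n.+1) : xs`_k = x k.
  by rewrite (nth_map k) ?size_enum_ord // nth_ord_enum.
have := Theta_recurrence t q0' xs0 uxs sxs.
rewrite -val_enum_ord [X in _ = X]big_map [X in _ = X]big_enum /= => rec.
have sumE : \sum_(i < n.+1) x i = \sum_(z <- xs) z by rewrite big_map big_enum.
have tn : t ^+ n != 0 by rewrite expf_neq0.
apply: (mulfI tn); rewrite sumE.
transitivity ((q / t) ^+ n / (1 - t) * alpha n q t *
   (t ^+ n * (\sum_(z <- xs) z) * Theta t n.+1 [seq q^-1 * z | z <- xs] xs)); first by ring.
rewrite rec !mulr_sumr; apply: eq_bigr => i _.
rewrite nthx others_lift partition_functionE big_map big_enum /= big_lift.
set th := Theta _ _ _ _.
set A := \prod_(_ in _) _; set B := \prod_(_ < n) _.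
(* With [r = x_j / x_i], the factor [q / t] that [alpha] gains for each j is absorbed by [(q / t) *
   t * (1 - t * q^-1 / r) = t * (1 - q * t^-1 * r) / (- r)]; this produces the factors
   [1 - q t^-1 x_j / x_i] and [- x_j / x_i] of the recurrence. *)
suff E : (q / t) ^+ n * A = t ^+ n * B.
  transitivity (x i * (alpha n q t * th) * ((q / t) ^+ n * A)); last by rewrite E; ring.
  by move: ((q / t) ^+ n) => w; field.
rewrite /A /B.
have constE (a : R) : a ^+ n = \prod_(j < n) a by rewrite prodr_const card_ord.
rewrite !constE -!big_split /=; apply: eq_bigr => j _.
have a0 := x0 i; have b0 := x0 (lift i j).
have ab : x i - x (lift i j) != 0.
  by rewrite subr_eq0 (inj_eq xinj) neq_lift.
by field; rewrite ?q0 ?t0 ?a0 ?ab ?oppr_eq0 ?b0.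
Qed.

(** Removing entries by value instead of by position makes every ingredient of the right-hand side,
    except the smaller matrix elements, visibly independent of the order of xs; symmetry then
    follows by induction. *)
Lemma Theta_recurrence_rem xs m : q != 0 -> 0 \notin xs -> uniq xs -> size xs = m.+1 ->
  t ^+ m * (\sum_(x <- xs) x) * Z xs =
  \sum_(z <- xs) z * ((1 - t) * Z (rem z xs)
    * \prod_(x <- rem z xs)
       ((1 - t * (x / z)) * (t * (1 - q^-1 * (x / z))) * (1 - t * (q^-1 * (z / x)))
         / (1 - x / z))).
Proof.
move=> q0 xs0 uxs sxs; have q0' : q^-1 != 0 by rewrite invr_eq0.
rewrite sxs Theta_recurrence // -sxs [RHS](big_nth 0) /index_iota subn0 big_seq [RHS]big_seq.
apply: eq_bigr => i; rewrite mem_iota add0n => /andP[_ hi].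
by rewrite size_rem ?mem_nth // sxs remE ?mem_nth // index_uniq.
Qed.

(** The induction divides by the sum of the entries at each stage, after any removals; hence the
    assumption on the sums of all nonempty sublists. *)
Lemma Theta_perm xs xs' : q != 0 -> t != 0 -> 0 \notin xs -> uniq xs ->
  (forall s, uniq s -> {subset s <= xs} -> s != [::] -> \sum_(x <- s) x != 0) ->
  perm_eq xs xs' -> Z xs = Z xs'.
Proof.
move=> q0 t0; move e : (size xs) => m; move/esym: e.
elim: m xs xs' => [|m IH] xs xs' sxs xs0 uxs hsum pxs.
  have /esym/size0nil e := sxs; move: (pxs); rewrite e perm_sym => /perm_nilP ->.
  by [].
have p0 : t ^+ m * (\sum_(x <- xs) x) != 0.
  by rewrite mulf_neq0 ?expf_neq0 ?hsum // -size_eq0 -sxs.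
apply: (mulfI p0).
have sumE : \sum_(x <- xs) x = \sum_(x <- xs') x by exact: perm_big.
rewrite {1}sxs Theta_recurrence_rem // sumE.
rewrite Theta_recurrence_rem -?(perm_mem pxs) -?(perm_uniq pxs) -?(perm_size pxs) //.
rewrite (perm_big _ pxs) /= big_seq [RHS]big_seq; apply: eq_bigr => z.
rewrite -(perm_mem pxs) => zxs.
have pr : perm_eq (rem z xs) (rem z xs').
  by rewrite -(perm_cons z) -(permPl (perm_to_rem zxs)) -(permPr (perm_to_rem _)) -?(perm_mem pxs).
rewrite (perm_big _ pr) /=.
have -> // : Z (rem z xs) = Z (rem z xs').
have sr : m = size (rem z xs) by rewrite size_rem // -sxs.
rewrite -sr; apply: IH => //.
- by apply: contra xs0; apply: mem_rem.
- exact: rem_uniq.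
- by move=> s us ss; apply: hsum => // x /ss; apply: mem_rem.
Qed.

Lemma partition_function_perm n (x : 'I_n -> R) (s : 'S_n) :
  q != 0 -> t != 0 -> injective x -> (forall i, x i != 0) ->
  (forall A : {set 'I_n}, A != set0 -> \sum_(i in A) x i != 0) ->
  partition_function q t (fun i => x (s i)) 1 = partition_function q t x 1.
Proof.
move=> q0 t0 xinj x0 hsum; rewrite !partition_functionE; congr (_ * _).
set xs := [seq x i | i <- enum 'I_n]; set xs' := [seq x (s i) | i <- enum 'I_n].
have sxs : n = size xs by rewrite size_map size_enum_ord.
have sxs' : n = size xs' by rewrite size_map size_enum_ord.
have pxs : perm_eq xs xs'.
  rewrite /xs' (map_comp x s); apply: perm_map; apply: uniq_perm.
  - exact: enum_uniq.
  - by rewrite (map_inj_uniq (@perm_inj _ s)) enum_uniq.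
  move=> i; rewrite mem_enum; apply/esym/mapP; exists ((s^-1)%g i); rewrite ?mem_enum //.
  by rewrite permKV.
rewrite {1}sxs' {1}[n in RHS]sxs; apply: esym; apply: Theta_perm pxs => //.
- by apply/mapP => -[i _ /esym/eqP]; exact/negP.
- by rewrite map_inj_uniq ?enum_uniq.
move=> l ul lxs ln0.
have <- : \sum_(i in [set i | x i \in l]) x i = \sum_(z <- l) z.
  rewrite -(big_enum _ _ _ x) /= -(big_map x predT id) /=; apply: perm_big; apply: uniq_perm => //.
    by rewrite map_inj_uniq ?enum_uniq.
  move=> z; apply/mapP/idP => [[i]|zl]; first by rewrite mem_enum inE => h ->.
  by have /mapP[i _ e] := lxs z zl; exists i; rewrite // mem_enum inE -e.
apply: hsum; case: l ul lxs ln0 => // z l _ /(_ z (mem_head _ _))/mapP[i _ e] _.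
by apply/set0Pn; exists i; rewrite inE -e mem_head.
Qed.

End PartitionFunction.

(** * Rational functions *)

Section RationalFunctions.
Variable K : fieldType.

HB.instance Definition _ n := GRing.RMorphism.copy (@ratC K n) (@FracField.tofrac _ \o @mpolyC n K).

Lemma pi_tofrac n (x : {ratio {mpoly K[n]}}) :
  ((\pi_(ratfun K n) x)%qT : ratfun K n) * tofrac \d_x = tofrac \n_x.
Proof.
unlock FracField.tofrac; rewrite -[LHS]FracField.pi_mul; apply/eqmodP.
rewrite /= FracField.equivfE /FracField.mulf !numden_Ratio ?mulr1 ?oner_eq0 ?denom_ratioP //.
by rewrite mulrC.
Qed.

Lemma repr_tofrac n (f : ratfun K n) :
  f * tofrac \d_(repr f) = tofrac \n_(repr f).
Proof. by rewrite -{1}[f]reprK pi_tofrac. Qed.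

Section Rename.
Variables (n m : nat) (phi : 'I_n -> 'I_m).
Hypothesis phi_inj : injective phi.

Definition mrename : {mpoly K[n]} -> {mpoly K[m]} := mmap (@mpolyC m K) (fun i => 'X_(phi i)).
Local Notation ev := (mmap (@ratC K m) (fun i => ratX K (phi i))).

Lemma ev_tofrac p : ev p = tofrac (mrename p).
Proof.
rewrite /mrename /mmap rmorph_sum /=; apply: eq_bigr => k _.
rewrite rmorphM rmorph_prod; congr (_ * _); apply: eq_bigr => i _.
by rewrite rmorphXn.
Qed.

Lemma mrename_inj p : mrename p = 0 -> p = 0.
Proof.
(* Substituting [h] undoes the renaming: a variable in the image of [phi] returns to its origin, and
   the others, which do not occur, go to 0. *)
pose h (j : 'I_m) : {mpoly K[n]} := if [pick i | phi i == j] is Some i then 'X_i else 0.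
have hphi i : h (phi i) = 'X_i.
  by rewrite /h; case: pickP => [j /eqP/phi_inj -> //|/(_ i)]; rewrite eqxx.
suff back : mmap (@mpolyC n K) h (mrename p) = p.
  by move=> e; rewrite -back e raddf0.
rewrite {1}/mrename {2}/mmap rmorph_sum [RHS]mpolyE; apply: eq_bigr => k _ /=.
rewrite rmorphM /= mmapC mul_mpolyC; congr (_ *: _).
rewrite rmorph_prod /= -[RHS]mmap1_id; apply: eq_bigr => i _.
by rewrite rmorphXn /= mmapX mmap1U hphi.
Qed.

Lemma ev_neq0 p : p != 0 -> ev p != 0.
Proof. by rewrite ev_tofrac tofrac_eq0; apply: contra_neq; apply: mrename_inj. Qed.

(** The proof of injectivity is an argument so that the morphism structures, which depend on it, can
    be attached to this constant. *)
Definition ratRename of injective phi : ratfun K n -> ratfun K m :=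
  fun f => ratEval f (fun i => ratX K (phi i)).
Local Notation F := (ratRename phi_inj).

(** An injective renaming kills no nonzero denominator, so any fraction representing f can replace
    the chosen representative in [ratEval]. Compatibility with the ring operations follows from
    this. *)
Lemma ratRename_frac f a b : b != 0 -> f * tofrac b = tofrac a -> F f * ev b = ev a.
Proof.
move=> b0 e; rewrite /ratRename /ratEval.
have d0 := denom_ratioP (repr f).
have e' : \n_(repr f) * b = a * \d_(repr f).
  apply/eqP; rewrite -tofrac_eq !tofracM -repr_tofrac -e; apply/eqP; ring.
have {}e' := congr1 ev e'; rewrite !rmorphM /= in e'.
by rewrite mulrAC e' mulfK // ev_neq0.
Qed.

Lemma ratRenameE f : F f * ev \d_(repr f) = ev \n_(repr f).
Proof. by apply: ratRename_frac; rewrite ?denom_ratioP ?repr_tofrac. Qed.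

Lemma ratRename_tofrac p : F (tofrac p) = ev p.
Proof.
have := @ratRename_frac (tofrac p) p 1 (oner_neq0 _).
by rewrite tofrac1 mulr1 rmorph1 mulr1 => ->.
Qed.

Lemma ratRename_is_zmod_morphism : zmod_morphism F.
Proof.
move=> f g.
set df := \d_(repr f); set dg := \d_(repr g).
have df0 : df != 0 := denom_ratioP _; have dg0 : dg != 0 := denom_ratioP _.
have ef := ratRenameE f; have eg := ratRenameE g.
have rf := repr_tofrac f; have rg := repr_tofrac g.
have := @ratRename_frac (f - g) (\n_(repr f) * dg - \n_(repr g) * df)
  (df * dg) (mulf_neq0 df0 dg0).
rewrite !tofracB !tofracM -rf -rg -/df -/dg => /(_ ltac:(ring)).
rewrite rmorphB !rmorphM /= -ef -eg -/df -/dg => e.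
apply: (mulIf (mulf_neq0 (ev_neq0 df0) (ev_neq0 dg0))); rewrite e; ring.
Qed.

Lemma ratRename_is_monoid_morphism : monoid_morphism F.
Proof.
split=> [|f g]; first by rewrite -[X in F X]tofrac1 ratRename_tofrac rmorph1.
set df := \d_(repr f); set dg := \d_(repr g).
have df0 : df != 0 := denom_ratioP _; have dg0 : dg != 0 := denom_ratioP _.
have ef := ratRenameE f; have eg := ratRenameE g.
have rf := repr_tofrac f; have rg := repr_tofrac g.
have := @ratRename_frac (f * g) (\n_(repr f) * \n_(repr g))
  (df * dg) (mulf_neq0 df0 dg0).
rewrite !tofracM -rf -rg -/df -/dg => /(_ ltac:(ring)).
rewrite !rmorphM /= -ef -eg -/df -/dg => e.
apply: (mulIf (mulf_neq0 (ev_neq0 df0) (ev_neq0 dg0))); rewrite e; ring.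
Qed.

End Rename.

HB.instance Definition _ n m (phi : 'I_n -> 'I_m) (phi_inj : injective phi) :=
  GRing.isZmodMorphism.Build _ _ (ratRename phi_inj) (ratRename_is_zmod_morphism phi_inj).
HB.instance Definition _ n m (phi : 'I_n -> 'I_m) (phi_inj : injective phi) :=
  GRing.isMonoidMorphism.Build _ _ (ratRename phi_inj) (ratRename_is_monoid_morphism phi_inj).

Lemma ratRenameC n m (phi : 'I_n -> 'I_m) (phi_inj : injective phi) c :
  ratRename phi_inj (ratC n c) = ratC m c.
Proof. by rewrite [LHS]ratRename_tofrac mmapC. Qed.

Lemma ratRenameX n m (phi : 'I_n -> 'I_m) (phi_inj : injective phi) i :
  ratRename phi_inj (ratX K i) = ratX K (phi i).
Proof. by rewrite [LHS]ratRename_tofrac mmapX mmap1U. Qed.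

Lemma ratC_eq0 n c : (ratC n c == 0) = (c == 0 :> K).
Proof. by rewrite tofrac_eq0 mpolyC_eq0. Qed.

Lemma tofrac_neq0 n (p : {mpoly K[n]}) v : p.@[v] != 0 -> (tofrac p : ratfun K n) != 0.
Proof. by rewrite tofrac_eq0; apply: contra_neq => ->; rewrite meval0. Qed.

Lemma ratX_sum_neq0 n (A : {set 'I_n}) : A != set0 -> \sum_(i in A) ratX K i != 0.
Proof.
case/set0Pn => a aA; rewrite -rmorph_sum; apply: (@tofrac_neq0 _ _ (fun i => (i == a)%:R)).
rewrite raddf_sum /= (bigD1 a) //= mevalXU eqxx big1 ?addr0 ?oner_neq0 // => i /andP[_ /negPf ne].
by rewrite mevalXU ne.
Qed.

Lemma ratX_neq0 n (i : 'I_n) : ratX K i != 0.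
Proof. by apply: (@tofrac_neq0 _ _ (fun=> 1)); rewrite mevalXU oner_neq0. Qed.

Lemma ratX_inj n : injective (@ratX K n).
Proof.
move=> i j /eqP; rewrite tofrac_eq => /eqP/(congr1 (meval (fun k => (k == i)%:R))).
rewrite !mevalXU eqxx; case: eqP => // _ /esym/eqP; rewrite eq_sym oner_eq0 //.
Qed.

Lemma ratX_neq1 n (i : 'I_n) : 1 - ratX K i != 0.
Proof.
rewrite -tofrac1 -rmorphB; apply: (@tofrac_neq0 _ _ (fun=> 0)).
by rewrite mevalB meval1 mevalXU subr0 oner_neq0.
Qed.

(** * Bounds on the exponents *)

Section Laurent.
Variable n : nat.
Local Notation expo := {ffun 'I_n -> int}.
Local Notation mono := (@laurent_monomial K n).

(** [laurent0] wants one coefficient per exponent, whereas expanding a product repeats exponents;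
    equal exponents are grouped and their coefficients added. *)
Lemma laurent0_sum (I : eqType) (r : seq I) (a : I -> K) (e : I -> expo) :
  (forall i, admissible_exponent (e i)) -> laurent0 (\sum_(i <- r) ratC n (a i) * mono (e i)).
Proof.
move=> he; exists (undup (map e r)), (fun x => \sum_(i <- r | e i == x) a i); split=> [x|].
  by rewrite mem_undup => /mapP[i _ ->].
rewrite (eq_bigr (fun x => \sum_(i <- r | e i == x) ratC n (a i) * mono (e i))) => [|x _].
  rewrite (exchange_big_dep xpredT) //= big_seq [RHS]big_seq; apply: eq_bigr => i ir.
  rewrite -big_filter (_ : [seq j <- undup (map e r) | e i == j] = [:: e i]) ?big_seq1 //.
  rewrite (eq_filter (a2 := pred1 (e i))) => [|x]; last by rewrite /= eq_sym.
  by rewrite filter_pred1_uniq ?undup_uniq // mem_undup map_f.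
rewrite rmorph_sum /= mulr_suml; apply: eq_bigr => i /eqP ->; by [].
Qed.

Lemma laurent_monomial0 : mono 0 = 1.
Proof. by rewrite /laurent_monomial big1 // => j _; rewrite ffunE expr0z. Qed.

Lemma laurent_monomialD e e' : mono (e + e') = mono e * mono e'.
Proof.
rewrite /laurent_monomial -big_split; apply: eq_bigr => j _ /=.
by rewrite ffunE expfzDr // ratX_neq0.
Qed.

Definition ratio_expo (i j : 'I_n) : expo := [ffun k => (k == i)%:Z - (k == j)%:Z].

Lemma laurent_monomial_ratio i j : mono (ratio_expo i j) = ratX K i / ratX K j.
Proof.
rewrite /laurent_monomial.
rewrite (eq_bigr (fun k => ratX K k ^ (k == i)%:Z * ratX K k ^ (- (k == j)%:Z))) => [|k _].
  rewrite big_split /=; congr (_ * _).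
    by rewrite (bigD1 i) //= eqxx expr1z big1 ?mulr1 // => k /negPf ->.
  by rewrite (bigD1 j) //= eqxx exprN1 big1 ?mulr1 // => k /negPf ->.
by rewrite ffunE expfzDr // ratX_neq0.
Qed.

Lemma sum_below m r : (\sum_(i < m) (i < r))%N = minn m r.
Proof.
elim: m => [|m IH]; first by rewrite big_ord0 min0n.
by rewrite big_ord_recr /= IH; case: ltnP; lia.
Qed.

(** The origin of the bound [r * (n - r)]: it counts the vertices (i, j) for which [x_i / x_j]
    raises the total degree in the first r variables. *)
Lemma sum_crossing r : (r <= n)%N ->
  \sum_(v : 'I_n * 'I_n) ((v.1 < r)%N && (r <= v.2)%N)%:Z = (r * (n - r))%:Z.
Proof.
move=> hr; rewrite -(pair_bigA _ (fun i j : 'I_n => ((i < r)%N && (r <= j)%N)%:Z)) /=.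
have posz_sum (F : 'I_n -> nat) : \sum_(i < n) (F i)%:Z = (\sum_(i < n) F i)%N%:Z.
  by rewrite (big_morph Posz PoszD (erefl _)).
have s1 : \sum_(i < n) (i < r)%N%:Z = r by rewrite posz_sum sum_below (minn_idPr hr).
have s2 : \sum_(j < n) (r <= j)%N%:Z = (n - r)%N.
  rewrite posz_sum; congr Posz; apply/eqP; rewrite -(eqn_add2l r) subnKC //.
  rewrite -{1}(minn_idPr hr) -sum_below -big_split /= -[X in _ == X]card_ord -sum1_card.
  by apply/eqP/eq_bigr => j _; case: ltnP.
rewrite PoszM -s1 -s2 mulr_suml; apply: eq_bigr => i _; rewrite mulr_sumr; apply: eq_bigr => j _.
by case: (i < r)%N; rewrite ?mul1r ?mul0r.
Qed.

Lemma admissible_ratios (g : 'I_n * 'I_n -> bool) :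
  admissible_exponent (\sum_v (if g v then ratio_expo v.1 v.2 else 0)).
Proof.
move=> r hr.
have hv (v : 'I_n * 'I_n) : \sum_(j < n | (j < r)%N) (if g v then ratio_expo v.1 v.2 else 0) j =
    if g v then (v.1 < r)%N%:Z - (v.2 < r)%N%:Z else 0.
  case: (g v); last by rewrite big1 // => j _; rewrite ffunE.
  have d (i : 'I_n) : \sum_(j < n | (j < r)%N) (j == i)%:Z = (i < r)%N%:Z.
    rewrite big_mkcond (bigD1 i) //= eqxx big1 ?addr0 => [|j /negPf ->]; last by case: ifP.
    by case: (i < r)%N.
  by rewrite -!d -sumrB; apply: eq_bigr => j _; rewrite ffunE.
have -> : \sum_(j < n | (j < r)%N) (\sum_v (if g v then ratio_expo v.1 v.2 else 0)) j =
   \sum_(v : 'I_n * 'I_n) (if g v then (v.1 < r)%N%:Z - (v.2 < r)%N%:Z else 0).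
  rewrite (eq_bigr (fun j => \sum_v (if g v then ratio_expo v.1 v.2 else 0) j)) => [|j _].
    by rewrite exchange_big; apply: eq_bigr => v _; apply: hv.
  by rewrite sum_ffunE.
rewrite ler_norml -(sum_crossing hr); apply/andP; split.
  (* The lower bound is the upper bound after transposing the vertices, which inverts
     [x_i / x_j]. *)
  rewrite -sumrN [X in X <= _](reindex_inj (h := fun v : 'I_n * 'I_n => (v.2, v.1))) => [|[a b] [c d] [-> ->] //].
  by apply: ler_sum => -[i j] _ /=; case: (g _); case: (ltnP i r); case: (ltnP j r).
by apply: ler_sum => -[i j] _ /=; case: (g _); case: (ltnP i r); case: (ltnP j r).
Qed.

Lemma vertex_weight_affine (q t : K) (P : path_family n) (i j : 'I_n) :
  exists c : K * K, vertex_weight (ratC n q) (ratC n t) (@ratX K n) P i j =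
    ratC n c.1 + ratC n c.2 * (ratX K i / ratX K j).
Proof.
rewrite /vertex_weight.
case: ifP => _; first by exists (1 - t, 0); rewrite rmorphB rmorph1 rmorph0 mul0r addr0.
case: ifP => _.
  by exists (0, q^-1 * (1 - t)); rewrite rmorph0 rmorphM rmorphB rmorph1 fmorphV /=; ring.
case: ifP => _.
  by exists (t, - (t * q^-1)); rewrite rmorphN rmorphM fmorphV /=; ring.
case: ifP => _.
  by exists (1, - q^-1); rewrite rmorphN rmorph1 fmorphV /=; ring.
by exists (1, - (t * q^-1)); rewrite rmorphN rmorph1 rmorphM fmorphV /=; ring.
Qed.

(** Each vertex weight is a constant plus a constant multiple of [x_i / x_j]. Distributing the
    product gives one monomial for each set [g] of vertices where the second term is chosen, and its
    exponent is admissible whatever the paths are. *)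
Lemma laurent0_partition_function (q t : K) w :
  laurent0 (partition_function (ratC n q) (ratC n t) (@ratX K n) w).
Proof.
have [c hc] := boolp.choice (fun Pv : path_family n * ('I_n * 'I_n) =>
  vertex_weight_affine q t Pv.1 Pv.2.1 Pv.2.2).
rewrite /partition_function.
have -> : alpha n (ratC n q) (ratC n t) = ratC n (alpha n q t).
  by rewrite /alpha !rmorphM !rmorphXn fmorphV rmorphM fmorphV rmorphXn rmorphB rmorph1.
pose cf (P : path_family n) (g : {ffun 'I_n * 'I_n -> bool}) : K :=
  alpha n q t * \prod_v (if g v then (c (P, v)).2 else (c (P, v)).1).
pose ex (g : {ffun 'I_n * 'I_n -> bool}) : expo := \sum_v (if g v then ratio_expo v.1 v.2 else 0).
have -> : ratC n (alpha n q t) * \sum_(P | lattice_paths P && conn P w) wt (ratC n q) (ratC n t) (@ratX K n) P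
  = \sum_(Pg <- [seq (P, g) | P <- enum [pred P : path_family n | lattice_paths P && conn P w],
       g <- enum {ffun 'I_n * 'I_n -> bool}]) ratC n (cf Pg.1 Pg.2) * mono (ex Pg.2).
  rewrite big_allpairs big_enum /= mulr_sumr; apply: eq_bigr => P _.
  rewrite big_enum /= /wt (pair_bigA _ (fun i j => vertex_weight _ _ _ P i j)) /=.
  rewrite (eq_bigr (fun v => \sum_(b : bool) (if b then ratC n (c (P, v)).2 * mono (ratio_expo v.1 v.2)
       else ratC n (c (P, v)).1 * mono 0))) => [|v _]; last first.
    by rewrite big_bool /= laurent_monomial0 laurent_monomial_ratio mulr1 addrC (hc (P, v)).
  rewrite bigA_distr_bigA mulr_sumr; apply: eq_bigr => g _.
  have -> : ratC n (cf P g) = ratC n (alpha n q t) *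
      \prod_v ratC n (if g v then (c (P, v)).2 else (c (P, v)).1).
    by rewrite /cf; move: (alpha n q t) => a; rewrite rmorphM rmorph_prod.
  rewrite /ex (big_morph mono laurent_monomialD laurent_monomial0).
  rewrite -mulrA; congr (_ * _); rewrite -big_split; apply: eq_bigr => v _ /=.
  by case: (g v).
by apply: laurent0_sum => -[P g]; apply: admissible_ratios.
Qed.

End Laurent.

End RationalFunctions.

(** * Specialization to rational functions over Q(q,t) *)

Lemma rmorph_partition_function (R S : fieldType) (F : {rmorphism R -> S}) n (q t : R) x (w : 'S_n) :
  F (partition_function q t x w) = partition_function (F q) (F t) (fun i => F (x i)) w.
Proof.
rewrite /partition_function rmorphM rmorph_sum; congr (_ * _).
  by rewrite /alpha !rmorphM !rmorphXn fmorphV rmorphM fmorphV rmorphXn rmorphB rmorph1.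
apply: eq_bigr => P _; rewrite /wt !rmorph_prod; apply: eq_bigr => i _.
rewrite rmorph_prod; apply: eq_bigr => j _; rewrite /vertex_weight.
by do 4 (case: ifP => _; first by rewrite ?(rmorphM, rmorphB, rmorph1, fmorphV));
  rewrite ?(rmorphM, rmorphB, rmorph1, fmorphV).
Qed.

Lemma ratEval_f1 n m (phi : 'I_n -> 'I_m) : injective phi ->
  ratEval (f1 n) (fun i => ratX Fqt (phi i)) =
  partition_function (qn m) (tn m) (fun i => ratX Fqt (phi i)) 1.
Proof.
move=> phi_inj; rewrite -[LHS]/(ratRename phi_inj (f1 n)) rmorph_partition_function.
congr (partition_function _ _ _ _); first exact: ratRenameC; first exact: ratRenameC.
by apply/funext => i; apply: ratRenameX.
Qed.

Lemma qn_neq0 n : qn n != 0.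
Proof. by rewrite ratC_eq0 ratX_neq0. Qed.
Lemma tn_neq0 n : tn n != 0.
Proof. by rewrite ratC_eq0 ratX_neq0. Qed.
Lemma tn_neq1 n : 1 - tn n != 0.
Proof. by rewrite -(rmorph1 (@ratC Fqt n)) -rmorphB ratC_eq0 ratX_neq1. Qed.

Lemma f1_recurrence n : recurrence f1 n.
Proof.
rewrite /recurrence partition_function_recurrence.
- by apply: eq_bigr => i _; rewrite ratEval_f1 //; apply: lift_inj.
- exact: qn_neq0.
- exact: tn_neq0.
- exact: tn_neq1.
- exact: ratX_inj.
- exact: ratX_neq0.
Qed.

Theorem theorem2 :
  (forall n : nat, laurent0 (f1 n) /\ symmetric_ratfun (f1 n)) /\
  (f1 0%N = 1 /\ forall n : nat, recurrence f1 n) /\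
  (forall g : (forall n : nat, ratfun Fqt n),
     g 0%N = 1 -> (forall n : nat, recurrence g n) ->
     forall n : nat, g n = f1 n).
Proof.
split=> [n|].
  split; first exact: laurent0_partition_function.
  move=> s; rewrite (ratEval_f1 (@perm_inj _ s)) partition_function_perm //.
  - exact: qn_neq0.
  - exact: tn_neq0.
  - exact: ratX_inj.
  - exact: ratX_neq0.
  - by move=> A; apply: ratX_sum_neq0.
split; first by split; [exact: partition_function0 | exact: f1_recurrence].
(* Uniqueness: the coefficient of [g n.+1] in the recurrence is the sum of the variables, a nonzero
   element of a field, so it can be cancelled. *)
move=> g g0 grec; elim=> [|n IH]; first by rewrite g0 [RHS]partition_function0.
have p0 : \sum_(i < n.+1) ratX Fqt i != 0.
  have -> : \sum_(i < n.+1) ratX Fqt i = \sum_(i in setT) ratX Fqt i.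
    by apply: eq_bigl => i; rewrite inE.
  apply: ratX_sum_neq0.
  by apply/set0Pn; exists ord0; rewrite inE.
apply: (mulfI p0); have := grec n; have := f1_recurrence n; rewrite /recurrence => -> ->.
by rewrite IH.
Qed.
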